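(* Let $T>0$ and let $H=H(x,p)$ be a Hamiltonian on $\mathbb{R}^d\times\mathbb{R}^d$, convex in $p$, such that $\frac{\partial H}{\partial p}$ and $\frac{\partial H}{\partial x}$ are Lipschitz (uniformly with respect to $(x,p)$) with constants $L_1$ and $L_2$ respectively. Suppose that the initial distribution $\rho_0$ has compact support, that $\epsilon\in(0,1)$ is a given constant, that $M\in\mathbb{N}$ satisfies $M\ge \max\{T,\frac{T}{2}(L_1+L_2)e^{L_1+L_2}\}$, and that the time stepsize is $h=\frac{T}{M}$, with $t_i=ih$. Let $\tilde\Phi_h$ be a numerical integrator of order $r\ge 2$ for the Hamiltonian system $\dot x_t=\partial_pH(x_t,p_t)$, $\dot p_t=-\partial_xH(x_t,p_t)$. Let $\{x_{0}^{(k)}\}_{k=1}^N$ be initial samples drawn from $\rho_0$, with $p_0^{(k)}=\nabla g(x_0^{(k)})$, and let $(\tilde x_{t_i}^{(k)},\tilde p_{t_i}^{(k)})$ be the numerical solutions obtained from these initial data with $\tilde\Phi_h$. Assume that the (sufficiently regular) neural network $\psi_\theta:\mathbb{R}^d\times[0,T]\to\mathbb{R}$ is trained by minimizing the loss $$\mathrm{Loss}(\theta)=\frac1M\sum_{i=1}^M\Big(\frac1{N_0}\sum_{k=1}^{N_0}|\nabla_x\psi_\theta(\tilde x_{t_i}^{(k)},t_i)-\tilde p_{t_i}^{(k)}|^2\Big)$$ with these data (evaluated on random batches of size $N_0\le N$). Then with probability $1-\epsilon$, $\psi_\theta$ satisfies $$\int_{\mathbb{R}^d}\left|\nabla\left(\frac{\partial}{\partial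 t}\psi_\theta(x,t_i)+H(x,\nabla\psi_\theta(x,t_i))\right)\right|\tilde\rho_{t_i}(x)\,dx\le \frac12\lambda(\theta,i)h+\eta(\theta,i)h^{r-1}+\delta_i^{N,h}+\nu(\theta,i)\,\varepsilon_i^N+R(\theta,i)\sqrt{\frac{\ln M+\ln\frac2\epsilon}{2N}}$$ at $t_i=ih$ for all $i=1,\dots,M-1$. Here $\lambda(\theta,i),\eta(\theta,i),\nu(\theta,i),R(\theta,i)$ are non-negative constants depending on the parameter $\theta$, the time node $t_i$, the Hamiltonian $H$, the initial distribution $\rho_0$, and the numerical scheme $\tilde\Phi_h$.
   Context: Setting: the Hamilton--Jacobi equation $\partial_tu(x,t)+H(x,\nabla u(x,t))=0$, $u(x,0)=g(x)$, $t\in[0,T]$, $x\in\mathbb{R}^d$. $\nabla$ denotes the gradient in the spatial variable $x$; $|\cdot|$ is the Euclidean norm. $\rho_0$ is a probability density on $\mathbb{R}^d$. Numerical integrator: $\tilde\Phi_h:\mathbb{R}^{2d}\to\mathbb{R}^{2d}$ is the (continuous) one-step solution map of the scheme, and $(\tilde x_{t_i},\tilde p_{t_i})=\tilde\Phi_h^{(i)}(x_0,\nabla g(x_0))$, where $\tilde\Phi_h^{(i)}$ is the $i$-fold composition of $\tilde\Phi_h$. The scheme has local truncation error of order $r\ge2$: if $(x_h,p_h)$ is the exact solution of the Hamiltonian system after one time step $h$ from $(x_0,p_0)$, then $|\tilde\Phi_h(x_0,p_0)-(x_h,p_h)|=C_{\tilde\Phi_h}(x_0,p_0)h^r$, where $C_{\tilde\Phi_h}(x_0,p_0)$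 depends only on $H$, the initial condition $(x_0,p_0)$ and the numerical scheme. $\tilde\rho_{t_i}$ denotes the probability density of the random variable $\tilde x_{t_i}$ when $x_0\sim\rho_0$. Regularity of $\psi_\theta$: the network is assumed regular enough, for example $\psi_\theta\in\mathcal{C}^{1,2}([0,T]\times\mathbb{R}^d)\cap\mathcal{C}^{0,3}([0,T]\times\mathbb{R}^d)$ (first index for time, second for space). Training errors: $e_{t_i}^{(k)}=\nabla\psi_\theta(\tilde x_{t_i}^{(k)},t_i)-\tilde p_{t_i}^{(k)}$, and $$\varepsilon_i^N=\frac1N\sum_{k=1}^N|e_{t_i}^{(k)}|,\qquad \delta_i^{N,h}=\frac1N\sum_{k=1}^N\frac{|e_{t_{i+1}}^{(k)}-e_{t_i}^{(k)}|}{h}.$$ The probability is with respect to the random initial samples.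
   Formalization: ''Sufficiently regular'' is taken as: the network is C^3 jointly in parameter, space and time up to the ends of [0,T], since C^{1,2} ∩ C^{0,3} alone does not give constants independent of h; g is taken C^1 and the samples independent. *)

(* Defs.v *)
From HB Require Import structures.
From mathcomp Require Import all_boot all_order all_algebra.
From mathcomp Require Import all_classical all_reals all_analysis.
From mathcomp Require Import measurable_realfun.

Set Implicit Arguments.
Unset Strict Implicit.
Unset Printing Implicit Defensive.

Import Order.TTheory GRing.Theory Num.Theory.
Import numFieldNormedType.Exports.

Local Open Scope classical_set_scope.
Local Open Scope ring_scope.

(* Convertible to 'rV[R]_n, which has no canonical measurable structure. *)
Definition borel (R : realType) (n : nat) := g_sigma_algebraType (@open 'rV[R]_n).

Section lebesgue_rV.
Variable R : realType.

Definition cons_rV n (z : R * 'rV[R]_n) : 'rV[R]_n.+1 :=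
  row_mx (const_mx z.1 : 'rV[R]_1) z.2.

Lemma cons_rV_ball n (z w : R * 'rV[R]_n) e : 0 < e ->
  `|z.1 - w.1| < e -> (forall j, `|z.2 ord0 j - w.2 ord0 j| < e) ->
  ball (cons_rV z) e (cons_rV w).
Proof.
move=> e0 h1 h2; split => // i j; rewrite /ball /= !mxE.
case: splitP => k _; rewrite ?mxE //.
by rewrite (ord1 i); exact: h2.
Qed.

Lemma measurable_cons_rV n :
  measurable_fun [set: (measurableTypeR R * borel R n)%type]
    (@cons_rV n : measurableTypeR R * borel R n -> borel R n.+1).
Proof.
apply: (@measurability _ _ (measurableTypeR R * borel R n)%type (borel R n.+1)
  setT _ (@open 'rV[R]_n.+1)) => //.
move=> _ [U oU <-]; rewrite setTI.
pose D (i : rat * 'rV[rat]_n * nat) : set (measurableTypeR R * borel R n) :=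
  (ball (ratr i.1.1 : R) i.2.+1%:R^-1 : set (measurableTypeR R)) `*`
  (ball (map_mx ratr i.1.2 : 'rV[R]_n) i.2.+1%:R^-1 : set (borel R n)).
have mD i : measurable (D i).
  apply: measurableX.
    exact: open_measurable (ball_open _ _).
  exact: sub_sigma_algebra (ball_open _ _).
pose F (k : nat) := if unpickle k is Some i then
  if `[< D i `<=` @cons_rV n @^-1` U >] then D i else set0 else set0.
have Fpickle i : D i `<=` @cons_rV n @^-1` U -> F (pickle i) = D i.
  by move=> DU; rewrite /F pickleK asboolT.
rewrite (_ : _ @^-1` _ = \bigcup_k F k); last first.
  apply/seteqP; split => [z /= Uz|z [k _]]; last first.
    by rewrite /F; case: unpickle => // i; case: asboolP => // + Dz; exact.
  have [e /= e0 eU] : nbhs_ball (cons_rV z) U.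
    by rewrite nbhs_ballE; move/open_nbhs_nbhs: (conj oU Uz).
  have [k [_ /(_ k (leqnn k)) ke]] :
      exists k, True /\ forall m, (k <= m)%N -> m.+1%:R^-1 < e / 2.
    have : \forall m \near \oo, m.+1%:R^-1 < e / 2.
      by apply: near_infty_natSinv_lt (PosNum (divr_gt0 e0 (ltr0n _ 2))).
    by move=> [k _ hk]; exists k; split => // m; exact: hk.
  have k0 : 0 < k.+1%:R^-1 :> R by rewrite invr_gt0.
  have H (x : R) : exists q : rat, `|ratr q - x| < k.+1%:R^-1.
    have /rat_in_itvoo[q] : x - k.+1%:R^-1 < x + k.+1%:R^-1.
      by rewrite ltrBlDr -addrA ltrDl addr_gt0.
    by rewrite in_itv/= => qx; exists q; rewrite ltr_distl.
  have [q1 hq1] := H z.1.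
  have /choice[q2 hq2] j := H (z.2 ord0 j).
  have Dz : D (q1, \row_j q2 j, k) z.
    split; first exact: hq1.
    by split => // a b; rewrite (ord1 a) !mxE; exact: hq2.
  exists (pickle (q1, \row_j q2 j, k)); first exact: I.
  rewrite Fpickle; first exact: Dz.
  move=> w [w1 [_ w2]] /=; apply: eU.
  have step (a b c : R) : `|a - b| < k.+1%:R^-1 -> `|a - c| < k.+1%:R^-1 ->
      `|b - c| < e.
    move=> ab ac; rewrite (le_lt_trans (ler_distD a _ _)) //.
    by rewrite [e]splitr distrC ltrD // (lt_trans _ ke).
  apply: cons_rV_ball => //; first exact: step hq1 w1.
  move=> j; apply: step (hq2 j) _.
  by have := w2 ord0 j; rewrite /= !mxE.
apply: bigcupT_measurable => k; rewrite /F.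
by case: unpickle => // i; case: ifP.
Qed.

(* Lebesgue measure on R^n.  [\x^] is the product measure of the library that
   requires sigma-finiteness of its first factor only. *)
Fixpoint leb n : {measure set (borel R n) -> \bar R} :=
  if n is n'.+1 return {measure set (borel R n) -> \bar R} then
    measure_function_pushforward__canonical__measure_function_Measure
      (lebesgue_measure \x^ leb n')%E (@measurable_cons_rV n')
  else dirac ((0 : 'rV[R]_0) : borel R 0).

End lebesgue_rV.

Section calculus.
Variable R : realType.

Definition enorm n (v : 'rV[R]_n) : R := Num.sqrt (\sum_(j < n) v ord0 j ^+ 2).

Definition grad n (f : 'rV[R]_n -> R) (x : 'rV[R]_n) : 'rV[R]_n :=
  \row_j 'D_(delta_mx ord0 j) f x.

Fixpoint Ck (V : normedModType R) (k : nat) (f : V -> R) : Prop :=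
  if k is k'.+1 then
    (forall x, differentiable f x) /\ (forall v, Ck k' (fun x => 'D_v f x))
  else continuous f.

(* C^k on a closed set (here up to the boundary of a time interval) is read as
   the existence of a C^k extension to the whole space. *)
Definition Ck_on (V : normedModType R) (k : nat) (A : set V) (f : V -> R) :=
  exists2 F : V -> R, Ck k F & {in A, F =1 f}.

End calculus.

Section hamiltonian.
Variables (R : realType) (d : nat).
Implicit Types (H : 'rV[R]_d -> 'rV[R]_d -> R) (z w : 'rV[R]_d * 'rV[R]_d).

Definition dHp H z : 'rV[R]_d := grad (H z.1) z.2.
Definition dHx H z : 'rV[R]_d := grad (fun x => H x z.2) z.1.

(* Euclidean norm on the phase space R^d x R^d = R^(2d). *)
Definition pnorm z : R := enorm (row_mx z.1 z.2).

Definition lipschitz_with (L : R)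
    (F : 'rV[R]_d * 'rV[R]_d -> 'rV[R]_d) :=
  forall z w, enorm (F z - F w) <= L * pnorm (z - w).

Definition hamiltonian_solution H (h : R) (z : R -> 'rV[R]_d * 'rV[R]_d) :=
  {within `[0, h], continuous z} /\
  (forall t, t \in `]0, h[ ->
    is_derive t 1 (fun s => (z s).1) (dHp H (z t)) /\
    is_derive t 1 (fun s => (z s).2) (- dHx H (z t))).

(* [C z0] may depend on the initial condition but not on the step, and is
   bounded on compact sets; steps are restricted to (0, 1]. *)
Definition integrator_of_order H
    (Phi : R -> 'rV[R]_d * 'rV[R]_d -> 'rV[R]_d * 'rV[R]_d) (r : nat) :=
  (forall h, 0 < h <= 1 -> continuous (Phi h)) /\
  exists2 C : 'rV[R]_d * 'rV[R]_d -> R,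
    forall K, compact K -> exists c, forall z0, K z0 -> C z0 <= c
  & forall (h : R) (z : R -> 'rV[R]_d * 'rV[R]_d), 0 < h <= 1 -> hamiltonian_solution H h z ->
      pnorm (Phi h (z 0) - z h) <= C (z 0) * h ^+ r.

Definition numsol (Phi : R -> 'rV[R]_d * 'rV[R]_d -> 'rV[R]_d * 'rV[R]_d)
    (g : 'rV[R]_d -> R) (h : R) (i : nat) (x0 : 'rV[R]_d) :=
  iter i (Phi h) (x0, grad g x0).

Definition hj_residual H (u : 'rV[R]_d -> R -> R) (t : R) (x : 'rV[R]_d) : R :=
  'D_1 (u x) t + H x (grad (fun y => u y t) x).

Definition train_err Phi (g : 'rV[R]_d -> R) (u : 'rV[R]_d -> R -> R) h (i : nat) x0 :=
  grad (fun y => u y (i%:R * h)) (numsol Phi g h i x0).1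
    - (numsol Phi g h i x0).2.

Definition loss Phi g (u : 'rV[R]_d -> R -> R) h (M N : nat)
    (x0 : 'I_N -> 'rV[R]_d) (B : {set 'I_N}) : R :=
  M%:R^-1 * \sum_(1 <= i < M.+1)
    (#|B|%:R^-1 * \sum_(k in B) enorm (train_err Phi g u h i (x0 k)) ^+ 2).

Definition eps_err Phi g u h N (x0 : 'I_N -> 'rV[R]_d) (i : nat) : R :=
  N%:R^-1 * \sum_(k < N) enorm (train_err Phi g u h i (x0 k)).

Definition delta_err Phi g u h N (x0 : 'I_N -> 'rV[R]_d) (i : nat) : R :=
  N%:R^-1 * \sum_(k < N)
    enorm (train_err Phi g u h i.+1 (x0 k) - train_err Phi g u h i (x0 k)) / h.

End hamiltonian.

Section randomness.
Variables (R : realType) (d : nat).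

Definition has_density (mu : set (borel R d) -> \bar R)
    (f : borel R d -> R) :=
  [/\ measurable_fun setT f, forall x, 0 <= f x &
      forall A, measurable A -> mu A = (\int[leb R d]_(x in A) (f x)%:E)%E].

Definition prob_density (f : borel R d -> R) :=
  [/\ measurable_fun setT f, forall x, 0 <= f x &
      (\int[leb R d]_x (f x)%:E = 1)%E].

(* [rho] is the density of [Y x0] when [x0] has density [rho0]. *)
Definition image_density (rho0 : borel R d -> R)
    (Y : borel R d -> borel R d) (rho : borel R d -> R) :=
  has_density (fun A => (\int[leb R d]_(x in Y @^-1` A) (rho0 x)%:E)%E) rho.

Definition iid_samples (dO : measure_display) (Om : measurableType dO)
    (P : probability Om R) (N : nat) (rho0 : borel R d -> R)
    (X : 'I_N -> Om -> borel R d) :=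
  [/\ forall k, measurable_fun setT (X k),
      forall k, has_density (pushforward P (X k)) rho0 &
      forall B : 'I_N -> set (borel R d), (forall k, measurable (B k)) ->
        P [set w | forall k, B k (X k w)] =
        (\prod_(k < N) P (X k @^-1` B k))%E].

End randomness.

(* Main.v *)
Require Import Defs.
From HB Require Import structures.
From mathcomp Require Import all_boot all_order all_algebra.
From mathcomp Require Import all_classical all_reals all_analysis.
From mathcomp Require Import measurable_realfun.
From mathcomp Require Import ring lra.

Set Implicit Arguments.
Unset Strict Implicit.
Unset Printing Implicit Defensive.

Import Order.TTheory GRing.Theory Num.Theory.
Import numFieldNormedType.Exports.

Local Open Scope classical_set_scope.
Local Open Scope ring_scope.

(** Write [e_i] for the error between the gradient of the network and the
numerical momentum at time [t_i] along a numerical trajectory [(x_i, p_i)].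

The mechanism is that the residual gradient is a derivative of the error along
the flow.  Differentiating [u_t + H(x, grad u)] in [x] gives, by symmetry of
second derivatives, [d/dt (grad u) + (grad^2 u) H_p + H_x] ([grad_residual]): the
derivative of [grad u] in the direction [(H_p, 1)], plus [H_x].  Along the numerical
trajectory [(x_(i+1) - x_i) / h] is [H_p] and [(p_(i+1) - p_i) / h] is [- H_x], up
to [O(h)] when both are evaluated at [(x_i, p_i)].  Taylor's formula for [grad u]
therefore shows that [(e_(i+1) - e_i) / h] is the residual gradient at [x_i], up to
[O(h)] and up to a multiple of [|e_i|] that pays for evaluating [H_p] and [H_x] at
[p_i] instead of [grad u] ([residual_estimate]).  All constants come from compact
sets, so numerical trajectories must stay in one ball whatever the number of
steps.  The order condition compares the integrator with exact solutions; these
are built by Picard iteration ([picard_lindelof]), the comparison yields the [O(h)]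
consistency above ([integrator_consistent]), a discrete Gronwall argument handles
small steps, and the finitely many large steps are handled by continuity
([integrator_bounded]).

It remains to pass from the density of [x_i] to the samples.  For one parameter
this is Hoeffding's inequality ([finite_hoeffding], [sample_hoeffding]).  But the
trained parameter depends on the samples, so the inequality is needed for all
parameters at once.  In each ball of integer radius [j] take a grid of mesh
[1 / M].  Replacing a parameter by a grid point costs [O(1 / M) = O(h)], which the
term in [lambda] absorbs; the number of grid points is polynomial in [M], so the
union bound costs a multiple of [ln M], which the square root absorbs
([log_confidence]).  The balls [j = 0, 1, 2, ...] share the failure probability in
the proportions [1 / 2^(j+1)].  For the same reason the residual may be rounded to
multiples of [1 / M]: independence is then needed only for finitely many product
events, and the concentration inequality is one about finite sums
([deviation_event]). *)

(** * Norms and continuity *)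

Section euclidean_norm.
Variable R : realType.
Implicit Types (n : nat).

Lemma enorm_ge0 n (v : 'rV[R]_n) : 0 <= enorm v.
Proof. exact: sqrtr_ge0. Qed.

Lemma sqr_enorm n (v : 'rV[R]_n) : enorm v ^+ 2 = \sum_(j < n) v ord0 j ^+ 2.
Proof. by rewrite sqr_sqrtr // sumr_ge0 // => j _; exact: sqr_ge0. Qed.

Lemma coord_le_norm n (v : 'rV[R]_n) j : `|v ord0 j| <= `|v|.
Proof.
by rewrite [leRHS]/Num.Def.normr /= mx_normrE; exact: (le_bigmax _ _ (ord0, j)).
Qed.

Lemma norm_le_coord n (v : 'rV[R]_n) (c : R) :
  0 <= c -> (forall j, `|v ord0 j| <= c) -> `|v| <= c.
Proof.
move=> c0 h; rewrite [leLHS]/Num.Def.normr /= mx_normrE.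
by apply: bigmax_le => // -[i j] _ /=; rewrite (ord1 i).
Qed.

Lemma norm_le_enorm n (v : 'rV[R]_n) : `|v| <= enorm v.
Proof.
apply: norm_le_coord; first exact: enorm_ge0.
move=> j; rewrite -sqrtr_sqr ler_sqrt ?sumr_ge0 // => [|i _]; last exact: sqr_ge0.
by rewrite (bigD1 j) //= lerDl sumr_ge0 // => i _; exact: sqr_ge0.
Qed.

Lemma enorm_le_sum n (v : 'rV[R]_n) : enorm v <= \sum_(j < n) `|v ord0 j|.
Proof.
have s0 : 0 <= \sum_(j < n) `|v ord0 j| by exact: sumr_ge0.
rewrite -(ger0_norm s0) -sqrtr_sqr ler_sqrt ?sqr_ge0 // expr2 mulr_suml.
apply: ler_sum => j _; rewrite -[v ord0 j ^+ 2]real_normK ?num_real // expr2.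
by rewrite ler_wpM2l // (bigD1 j) //= lerDl sumr_ge0.
Qed.

Lemma enorm_le_norm n (v : 'rV[R]_n) : enorm v <= n%:R * `|v|.
Proof.
apply: le_trans (enorm_le_sum v) _.
rewrite -[n in n%:R]card_ord -sumr_const mulr_suml.
by apply: ler_sum => j _; rewrite mul1r; exact: coord_le_norm.
Qed.

Lemma cauchy_schwarz_sum n (a b : 'I_n -> R) :
  (\sum_j a j * b j) ^+ 2 <= (\sum_j a j ^+ 2) * (\sum_j b j ^+ 2).
Proof.
set A := \sum_j a j ^+ 2; set B := \sum_j b j ^+ 2; set C := \sum_j a j * b j.
have A0 : 0 <= A by apply: sumr_ge0 => j _; exact: sqr_ge0.
have h t : 0 <= A * t ^+ 2 - 2 * t * C + B.
  rewrite (_ : _ + B = \sum_j (t * a j - b j) ^+ 2); last first.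
    rewrite /A /B /C mulr_suml !mulr_sumr -sumrB -big_split /=.
    by apply: eq_bigr => j _; ring.
  by apply: sumr_ge0 => j _; exact: sqr_ge0.
have [A00|An0] := eqVneq A 0; last first.
  have Ap : 0 < A by rewrite lt_neqAle eq_sym An0.
  have := h (C / A); rewrite -(pmulr_rge0 _ Ap).
  have E (x y z : R) : x != 0 ->
    x * (x * (z / x) ^+ 2 - 2 * (z / x) * z + y) = x * y - z ^+ 2.
    by move=> x0; field.
  by rewrite (E A B C) // subr_ge0.
rewrite A00 mul0r /C big1 ?expr0n // => j _.
have /eqP : A = 0 by [].
rewrite /A psumr_eq0 => [/allP/(_ j)|i _]; last exact: sqr_ge0.
by rewrite mem_index_enum => /(_ isT); rewrite /= sqrf_eq0 => /eqP ->; rewrite mul0r.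
Qed.

(** The Minkowski inequality, squared, is the Cauchy-Schwarz inequality. *)
Lemma enormD n (v w : 'rV[R]_n) : enorm (v + w) <= enorm v + enorm w.
Proof.
have s0 := addr_ge0 (enorm_ge0 v) (enorm_ge0 w).
rewrite -(ger0_norm s0) -sqrtr_sqr [enorm (v + w)]/enorm ler_sqrt ?sqr_ge0 //.
rewrite sqrrD !sqr_enorm -mulr_natl.
rewrite (eq_bigr (fun j => v ord0 j ^+ 2 + 2 * (v ord0 j * w ord0 j) + w ord0 j ^+ 2)); last first.
  by move=> j _; rewrite mxE sqrrD mulr_natl.
rewrite !big_split /= lerD2r lerD2l -mulr_sumr ler_wpM2l //.
rewrite -sqrtrM ?sumr_ge0 // => [|i _]; last exact: sqr_ge0.
apply: le_trans (ler_norm _) _; rewrite -sqrtr_sqr ler_sqrt.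
  exact: cauchy_schwarz_sum.
by apply: mulr_ge0; apply: sumr_ge0 => i _; exact: sqr_ge0.
Qed.

Lemma enormZ n (c : R) (v : 'rV[R]_n) : enorm (c *: v) = `|c| * enorm v.
Proof.
rewrite /enorm -sqrtr_sqr -sqrtrM ?sqr_ge0 // mulr_sumr.
by congr Num.sqrt; apply: eq_bigr => j _; rewrite mxE exprMn.
Qed.

Lemma enormN n (v : 'rV[R]_n) : enorm (- v) = enorm v.
Proof. by rewrite /enorm; congr Num.sqrt; apply: eq_bigr => j _; rewrite mxE sqrrN. Qed.

Lemma enorm_dist n (v w : 'rV[R]_n) :
  `|enorm v - enorm w| <= enorm (v - w).
Proof.
have h1 := enormD (v - w) w; rewrite subrK in h1.
have h2 := enormD (w - v) v; rewrite subrK -(enormN (w - v)) opprB in h2.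
by rewrite ler_norml; apply/andP; split; lra.
Qed.

End euclidean_norm.

Section continuity.
Variable R : realType.
Implicit Types (n : nat).

Lemma norm_fst (V W : normedModType R) (z : V * W) : `|z.1| <= `|z|.
Proof. by rewrite prod_normE /= le_max lexx. Qed.

Lemma norm_snd (V W : normedModType R) (z : V * W) : `|z.2| <= `|z|.
Proof. by rewrite prod_normE /= le_max lexx orbT. Qed.

Lemma norm_pair (V W : normedModType R) (z : V * W) (c : R) :
  `|z.1| <= c -> `|z.2| <= c -> `|z| <= c.
Proof. by move=> h1 h2; rewrite prod_normE /= ge_max h1 h2. Qed.

(** Every constant below is the supremum of a continuous function over such a
ball. *)
Lemma compact_ball_row n (rho : R) : compact [set x : 'rV[R]_n | `|x| <= rho].
Proof.
apply: bounded_closed_compact.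
  by exists rho; split; [exact: num_real|move=> x rx y Ay; exact: le_trans Ay (ltW rx)].
have -> : [set x : 'rV[R]_n | `|x| <= rho]
  = (fun x : 'rV[R]_n => `|x|) @^-1` [set y | y <= rho] by [].
by apply: closed_comp; [move=> x _; exact: norm_continuous|exact: closed_le].
Qed.

Lemma lip_continuous (V W : normedModType R) (f : V -> W) (K : R) :
  (forall t s, `|f t - f s| <= K * `|t - s|) -> continuous f.
Proof.
move=> h t; apply/cvgrPdist_le => e e0; near=> s.
apply: le_trans (h _ _) _.
apply: (@le_trans _ _ ((`|K| + 1) * `|t - s|)).
  by rewrite ler_wpM2r // ler_wpDr // ler_norm.
rewrite mulrC -ler_pdivlMr ?ltr_wpDl //.
near: s; apply/nbhs_ballP; exists (e / (`|K| + 1)) => /=.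
  by rewrite divr_gt0 // ltr_wpDl.
by move=> s; rewrite -ball_normE /ball_ /= => /ltW.
Unshelve. all: by end_near. Qed.

Lemma row_continuous (U : topologicalType) n (f : 'I_n -> U -> R) :
  (forall j, continuous (f j)) -> continuous (fun x => \row_j f j x : 'rV[R]_n).
Proof.
move=> fc x; apply/cvgrPdist_le => e e0.
have : \forall y \near x, forall j, `|f j x - f j y| <= e.
  by apply: filter_forall => j; have /cvgrPdist_le := fc j x; apply.
apply: filterS => y hy; apply: norm_le_coord; first exact: ltW.
by move=> j; rewrite !mxE.
Qed.

Lemma pair_continuous (U : topologicalType) (V W : normedModType R) (f : U -> V) (k : U -> W) :
  continuous f -> continuous k -> continuous (fun x => (f x, k x)).
Proof.
move=> fc kc x; apply/cvgrPdist_le => e e0.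
have /cvgrPdist_le/(_ e e0) h1 := fc x; have /cvgrPdist_le/(_ e e0) h2 := kc x.
near=> y; apply: norm_pair => /=; near: y; [exact: h1|exact: h2].
Unshelve. all: by end_near. Qed.

Lemma bigsum_continuous (U : topologicalType) (I : Type) (s : seq I)
  (f : I -> U -> R) :
  (forall i, continuous (f i)) -> continuous (fun x => \sum_(i <- s) f i x).
Proof.
move=> fc; elim: s => [|i s IH] x.
  by rewrite (_ : (fun _ => _) = cst 0); [exact: cst_continuous|apply/funext => y; rewrite big_nil].
rewrite (_ : (fun _ => _) = (fun y => f i y + \sum_(j <- s) f j y)).
  by apply: continuousD; [exact: fc|exact: IH].
by apply/funext => y; rewrite big_cons.
Qed.

Lemma enorm_continuous n : continuous (@enorm R n).
Proof.
move=> x; apply: (@continuous_comp _ _ _ (fun v : 'rV[R]_n => \sum_(j < n) v ord0 j ^+ 2)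
  Num.sqrt); last exact: sqrt_continuous.
apply: bigsum_continuous => j {}x.
apply: (@continuous_comp _ _ _ (fun v : 'rV[R]_n => v ord0 j) (fun t => t ^+ 2)).
  exact: coord_continuous.
exact: exprn_continuous.
Qed.

End continuity.

(** * Initial value problems *)

Section ode.
Variable R : realType.
Notation mu := (@lebesgue_measure R).

(** The base point [-1] makes the primitive differentiable at [0], so that no
one-sided derivative appears at the initial time. *)
Definition primitive (f : R -> R) (t : R) : R :=
  \int[mu]_(s in `[-1, t]) f s - \int[mu]_(s in `[-1, 0]) f s.

Lemma primitive0 f : primitive f 0 = 0.
Proof. by rewrite /primitive subrr. Qed.

Lemma is_derive_primitive (f : R -> R) (t : R) : continuous f -> -1 < t ->
  is_derive t 1 (primitive f) (f t).
Proof.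
move=> fc t1; pose F : R -> R := fun x => \int[mu]_(s in `[-1, x]) f s.
have [dF F'] : derivable F t 1 /\ derive1 F t = f t.
  apply: (@continuous_FTC1_closed _ f (-1) t (t + 1)) => //.
  - by rewrite ltrDl.
  - apply: continuous_compact_integrable; first exact: segment_compact.
    exact: continuous_subspaceT.
  - exact: fc.
have HF : is_derive t 1 F (f t).
  by apply: DeriveDef; [exact: dF|rewrite -derive1E].
set c := \int[mu]_(s in `[-1, 0]) f s.
have -> : primitive f = F - cst c by [].
by have := is_deriveB HF (is_derive_cst c t 1); rewrite subr0.
Qed.

(** Comparing derivatives replaces estimates of integrals: [phi - g] and [phi + g]
are nondecreasing. *)
Lemma mvt_bound (g phi dg dphi : R -> R) (a b : R) : a <= b ->
  (forall x, a <= x <= b -> is_derive x 1 g (dg x)) ->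
  (forall x, a <= x <= b -> is_derive x 1 phi (dphi x)) ->
  (forall x, a <= x <= b -> `|dg x| <= dphi x) ->
  `|g b - g a| <= phi b - phi a.
Proof.
move=> ab Dg Dphi le.
have key s : `|s| = 1 -> s * (g b - g a) <= phi b - phi a.
  move=> s1; pose f := phi - s *: g.
  have Df x : a <= x <= b -> is_derive x 1 f (dphi x - s * dg x).
    move=> xab; have := Dg x xab; have := Dphi x xab => ? ?.
    exact: is_deriveB.
  have [||c cab] := @MVT_segment R f (fun x => dphi x - s * dg x) a b ab.
  - by move=> x; rewrite in_itv /= => /andP[ax xb]; apply: Df; rewrite !ltW.
  - apply: derivable_within_continuous => x; rewrite in_itv /= => /Df Dfx.
    exact: ex_derive.
  rewrite in_itv /= in cab; rewrite /f /= => E.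
  have : 0 <= (dphi c - s * dg c) * (b - a).
    rewrite mulr_ge0 ?subr_ge0 //; apply: le_trans (le c cab).
    by rewrite -[`|dg c|]mul1r -s1 -normrM ler_norm.
  rewrite -E.
  move=> E'; have {}E' : 0 <= (phi b - s * g b) - (phi a - s * g a) by [].
  by rewrite mulrBr; lra.
rewrite ler_norml; apply/andP; split.
  have := key (-1); rewrite normrN1 => /(_ erefl) ?; lra.
by have := key 1; rewrite normr1 => /(_ erefl) ?; lra.
Qed.

(** Composing with this map turns iterates that are controlled on [[0, 1]] only
into functions that are continuous on the whole line. *)
Definition clamp (t : R) : R := Num.max 0 (Num.min 1 t).

Lemma clamp_itv t : 0 <= clamp t <= 1.
Proof. by rewrite /clamp le_max lexx /= ge_max ler01 ge_min lexx. Qed.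

Lemma clamp_id t : 0 <= t <= 1 -> clamp t = t.
Proof. by move=> /andP[t0 t1]; rewrite /clamp min_r // max_r. Qed.

Lemma clamp_lip t s : `|clamp t - clamp s| <= `|t - s|.
Proof.
wlog ts : t s / t <= s => [hw|].
  have [|/ltW] := leP t s; first exact: hw.
  by move=> /hw; rewrite distrC [leRHS]distrC.
rewrite [leRHS]distrC [leLHS]distrC (@ger0_norm _ (s - t)) ?subr_ge0 //.
rewrite /clamp /Num.max /Num.min.
by case: (ltP 1 s) => ?; case: (ltP 1 t) => ?; rewrite ?ltr01;
  try (case: (ltP 0 s) => ?); try (case: (ltP 0 t) => ?); rewrite ler_norml; apply/andP; split; lra.
Qed.

Lemma le_pow2_le0 (x C : R) : (forall k, x <= C / 2 ^+ k) -> x <= 0.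
Proof.
move=> h; rewrite leNgt; apply/negP => x0.
pose k := Num.Def.archi_bound (C / x).
have := h k; rewrite ler_pdivlMr ?exprn_gt0 // mulrC.
rewrite -ler_pdivlMr // => hk.
have C0 : C / x < k%:R.
  apply: archi_boundP; rewrite divr_ge0 ?ltW //.
  by apply: lt_le_trans x0 _; have := h 0%N; rewrite expr0 divr1.
have : k%:R <= 2 ^+ k :> R by rewrite -natrX ler_nat ltnW // ltn_expl.
by move=> ?; lra.
Qed.

Lemma geometric_cauchy (u : nat -> R) (E : R) :
  (forall k, `|u k.+1 - u k| <= E / 2 ^+ k) ->
  exists l, forall k, `|u k - l| <= 2 * E / 2 ^+ k.
Proof.
move=> hu.
have E0 : 0 <= E by have := hu 0%N; rewrite expr0 divr1; apply: le_trans.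
have hm k m : `|u (k + m)%N - u k| <= 2 * E / 2 ^+ k - 2 * E / 2 ^+ (k + m).
  elim: m => [|m IH]; first by rewrite addn0 !subrr normr0.
  rewrite addnS -(subrKA (u (k + m)%N)).
  apply: le_trans (ler_normD _ _) _; apply: le_trans (lerD (hu _) IH) _.
  rewrite exprS invfM mulrA mulrAC [_ * 2^-1]mulrAC divff // mul1r.
  by rewrite le_eqVlt; apply/orP; left; apply/eqP; lra.
have cu : cvgn u.
  apply/cauchy_cvgP/cauchy_ballP => e e0; near_simpl.
  have [k hk] : exists k, 4 * E / 2 ^+ k < e.
    apply/not_existsP => h; have : e <= 0.
      by apply: (@le_pow2_le0 _ (4 * E)) => k; rewrite leNgt; exact/negP/h.
    by rewrite leNgt e0.
  near=> n p.
  have ball1 q : (k <= q)%N -> `|u q - u k| <= 2 * E / 2 ^+ k.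
    move=> kq; rewrite -(subnKC kq); apply: le_trans (hm _ _) _.
    by rewrite gerBl divr_ge0 ?exprn_ge0 ?mulr_ge0.
  rewrite /ball /= -(subrKA (u k)); apply: le_lt_trans (ler_normD _ _) _.
  rewrite [X in _ + X]distrC; apply: le_lt_trans hk.
  rewrite (_ : 4 * E / 2 ^+ k = 2 * E / 2 ^+ k + 2 * E / 2 ^+ k); last by lra.
  by apply: lerD; apply: ball1; [near: n|near: p]; exact: nbhs_infty_ge.
exists (limn u) => k.
have : (fun n => `|u k - u n|) @ \oo --> `|u k - limn u|.
  by apply: cvg_norm; apply: cvgB; [exact: cvg_cst|exact: cu].
move=> hc; apply: (cvgr_to_le hc).
near=> n.
have kn : (k <= n)%N by near: n; exact: nbhs_infty_ge.
rewrite distrC -(subnKC kn); apply: le_trans (hm _ _) _.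
by rewrite gerBl divr_ge0 ?exprn_ge0 ?mulr_ge0.
Unshelve. all: by end_near. Qed.

Lemma is_derive_coordP n (f : R -> 'rV[R]_n) (df : 'rV[R]_n) (t : R) :
  (forall j, is_derive t 1 (fun s => f s ord0 j) (df ord0 j)) ->
  is_derive t 1 f df.
Proof.
move=> h; have dj j := @ex_derive _ _ _ _ _ _ _ (h j).
have Df : derivable f t 1 by apply/derivable_mxP => i j; rewrite (ord1 i).
apply: DeriveDef => //; rewrite derive_mx //.
by apply/rowP => j; rewrite mxE; case: (h j).
Qed.

Lemma near_is_derive (V : normedModType R) (f g : R -> V) df (t : R) :
  (\forall s \near t, f s = g s) -> is_derive t 1 f df -> is_derive t 1 g df.
Proof.
move=> fg [dfD dfE]; apply: DeriveDef.
  by apply: near_eq_derivable dfD => //; exact: oner_neq0.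
by rewrite -dfE; apply/esym/near_eq_derive => //; exact: oner_neq0.
Qed.

End ode.

Section picard.
Variables (R : realType) (n : nat) (F : 'rV[R]_n -> 'rV[R]_n) (L : R) (z0 : 'rV[R]_n).
Hypothesis L0 : 0 <= L.
Hypothesis FL : forall x y, `|F x - F y| <= L * `|x - y|.

Lemma field_continuous : continuous F.
Proof. exact: lip_continuous FL. Qed.

Definition picard_step (w : R -> 'rV[R]_n) (t : R) : 'rV[R]_n :=
  z0 + \row_j primitive (fun s => F (w s) ord0 j) (clamp t).

Lemma comp_coord_continuous (w : R -> 'rV[R]_n) j : continuous w -> continuous (fun s => F (w s) ord0 j).
Proof.
move=> wc t; apply: (@continuous_comp _ _ _ (F \o w) (fun v : 'rV[R]_n => v ord0 j)).
  by apply: continuous_comp; [exact: wc|exact: field_continuous].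
exact: coord_continuous.
Qed.

Lemma picard_step0 w : picard_step w 0 = z0.
Proof.
apply/rowP => j; rewrite !mxE clamp_id ?lexx ?ler01 // primitive0.
exact: addr0.
Qed.

Lemma primitive_bound (w1 w2 : R -> 'rV[R]_n) j (phi dphi : R -> R) (a b : R) : 0 <= a <= b ->
  continuous w1 -> continuous w2 ->
  (forall x, a <= x <= b -> is_derive x 1 phi (dphi x)) ->
  (forall x, a <= x <= b -> `|F (w1 x) ord0 j - F (w2 x) ord0 j| <= dphi x) ->
  `|(primitive (fun s => F (w1 s) ord0 j) b - primitive (fun s => F (w2 s) ord0 j) b)
   - (primitive (fun s => F (w1 s) ord0 j) a - primitive (fun s => F (w2 s) ord0 j) a)|
    <= phi b - phi a.
Proof.
move=> /andP[a0 ab] c1 c2 Dphi h.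
apply: (@mvt_bound R (primitive (fun s => F (w1 s) ord0 j) - primitive (fun s => F (w2 s) ord0 j)) phi
  (fun x => F (w1 x) ord0 j - F (w2 x) ord0 j) dphi a b ab) => // x /andP[ax xb].
have x1 : -1 < x by rewrite (lt_le_trans _ (le_trans a0 ax)).
by apply: is_deriveB; apply: is_derive_primitive => //; exact: comp_coord_continuous.
Qed.

Lemma is_derive_exp (c d x : R) :
  is_derive x 1 (fun s => c * s + d * expR (2 * L * s)) (c + d * (2 * L * expR (2 * L * x))).
Proof.
apply: is_deriveD.
  rewrite -[X in is_derive _ _ _ X]mulr1; exact: is_deriveZ.
apply: (@is_deriveZ _ _ _ (fun s => expR (2 * L * s))).
rewrite [X in is_derive _ _ _ X]mulrC.
apply: (@is_derive1_comp R expR (fun s => 2 * L * s)).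
rewrite -[X in is_derive _ _ _ X]mulr1; exact: is_deriveZ.
Qed.

(** The weight [expR (2 * L * t)] makes the Picard operator a contraction of ratio
1/2 on the whole of [[0, 1]], whatever the Lipschitz constant: integrating [L]
times the weight gives at most half the weight.  No gluing of short-time solutions
is needed. *)
Lemma picard_step_contract (w1 w2 : R -> 'rV[R]_n) (K : R) : continuous w1 -> continuous w2 -> 0 <= K ->
  (forall t : R, 0 <= t <= 1 -> `|w1 t - w2 t| <= K * expR (2 * L * t)) ->
  forall t : R, 0 <= t <= 1 ->
    `|picard_step w1 t - picard_step w2 t| <= K / 2 * expR (2 * L * t).
Proof.
move=> c1 c2 K0 h t /andP[t0 t1].
apply: norm_le_coord; first by rewrite mulr_ge0 ?expR_ge0 ?divr_ge0.
move=> j; rewrite /picard_step !mxE opprD addrACA subrr add0r clamp_id ?t0 //.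
have := @primitive_bound w1 w2 j (fun s => 0 * s + K / 2 * expR (2 * L * s)) _ 0 t
  _ c1 c2 (fun x _ => is_derive_exp _ _ x).
rewrite lexx t0 !primitive0 subr0 subr0 => /(_ isT) H.
apply: le_trans (H _) _; last first.
  rewrite !mul0r !add0r gerBl mulr_ge0 ?expR_ge0 ?divr_ge0 //.
move=> x /andP[x0 xt].
have := coord_le_norm (F (w1 x) - F (w2 x)) j; rewrite !mxE => /le_trans; apply.
apply: le_trans (FL _ _) _.
have := h x; rewrite x0 (le_trans xt t1) => /(_ isT) hx.
apply: le_trans (ler_wpM2l L0 hx) _.
by rewrite le_eqVlt; apply/orP; left; apply/eqP; field.
Qed.

(** The iterates stay in a weighted ball around the initial point whose radius is
proportional to [|F z0|]; this is what makes the final bound linear in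
[|F z0|]. *)
Lemma picard_step_ball (w : R -> 'rV[R]_n) : continuous w ->
  (forall t : R, 0 <= t <= 1 -> `|w t - z0| <= `|F z0| * expR (2 * L * t)) ->
  forall t : R, 0 <= t <= 1 ->
    `|picard_step w t - z0| <= `|F z0| * expR (2 * L * t).
Proof.
move=> wc h t /andP[t0 t1]; set D := `|F z0|.
have D0 : 0 <= D by exact: normr_ge0.
have e1 : 1 <= expR (2 * L * t) by rewrite -[leLHS]expR0 ler_expR !mulr_ge0.
apply: norm_le_coord; first by rewrite mulr_ge0 ?expR_ge0.
move=> j; rewrite /picard_step !mxE [X in X - _]addrC addrK clamp_id ?t0 //.
pose phi (s : R) := D * s + D / 2 * expR (2 * L * s).
have := @mvt_bound R (primitive (fun s => F (w s) ord0 j)) phi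
  (fun x => F (w x) ord0 j) _ 0 t t0 _ (fun x _ => is_derive_exp _ _ x).
rewrite primitive0 subr0 => H.
apply: le_trans (H _ _) _.
- move=> x /andP[x0 _]; apply: is_derive_primitive; first exact: comp_coord_continuous.
  by apply: lt_le_trans x0.
- move=> x /andP[x0 xt].
  apply: le_trans (coord_le_norm _ j) _.
  rewrite -(subrK (F z0) (F (w x))); apply: le_trans (ler_normD _ _) _.
  rewrite addrC lerD2l; apply: le_trans (FL _ _) _.
  have := h x; rewrite x0 (le_trans xt t1) => /(_ isT) hx.
  apply: le_trans (ler_wpM2l L0 hx) _.
  by rewrite le_eqVlt; apply/orP; left; apply/eqP; rewrite -/D; field.
- rewrite /phi !mulr0 expR0 add0r mulr1.
  by have := ler_wpM2l D0 e1; have := ler_wpM2l D0 t1; rewrite !mulr1 => ? ?; lra.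
Qed.

Lemma picard_step_lip (w : R -> 'rV[R]_n) (K : R) : continuous w -> 0 <= K ->
  (forall t : R, 0 <= t <= 1 -> `|F (w t)| <= K) ->
  forall t s : R, `|picard_step w t - picard_step w s| <= K * `|t - s|.
Proof.
move=> wc K0 h t s.
apply: (@le_trans _ _ (K * `|clamp t - clamp s|)); last first.
  by rewrite ler_wpM2l // clamp_lip.
rewrite /picard_step; move: (clamp_itv t) (clamp_itv s).
move: (clamp t) (clamp s) => {}t {}s.
wlog st : s t / s <= t => [hw t01 s01|].
  have [|/ltW ts] := leP s t; first by move=> st; exact: hw.
  by rewrite distrC [X in _ <= _ * X]distrC; exact: hw.
move=> /andP[t0 t1] /andP[s0 s1].
rewrite [X in _ <= _ * X]ger0_norm ?subr_ge0 //.
apply: norm_le_coord; first by rewrite mulr_ge0 // subr_ge0.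
move=> j; rewrite !mxE opprD addrACA subrr add0r mulrBr.
apply: (@mvt_bound R _ (fun s => K * s) (fun x => F (w x) ord0 j) (fun=> K)) => //.
- move=> x /andP[sx _]; apply: is_derive_primitive; first exact: comp_coord_continuous.
  by apply: lt_le_trans (le_trans s0 sx).
- by move=> x _; rewrite -[X in is_derive _ _ _ X]mulr1; exact: is_deriveZ.
- move=> x /andP[sx xt]; apply: le_trans (coord_le_norm _ j) _.
  by apply: h; rewrite (le_trans s0 sx) (le_trans xt t1).
Qed.

(** The Picard iterates converge geometrically and are equi-Lipschitz, hence so is
their limit; a last integration, without clamping, makes the derivative available at
the end points of the interval too. *)
Lemma picard_lindelof : exists w : R -> 'rV[R]_n,
  [/\ w 0 = z0,
      forall t : R, 0 <= t <= 1 -> is_derive t 1 w (F (w t)) &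
      forall t : R, 0 <= t <= 1 -> `|w t - z0| <= (1 + L * expR (2 * L)) * `|F z0| * t].
Proof.
set D := `|F z0|; have D0 : 0 <= D by exact: normr_ge0.
pose K := (1 + L * expR (2 * L)) * D.
have K0 : 0 <= K by rewrite mulr_ge0 // addr_ge0 // mulr_ge0 // expR_ge0.
pose w k := iter k picard_step (cst z0).
have FK (v : R -> 'rV[R]_n) : continuous v ->
    (forall t : R, 0 <= t <= 1 -> `|v t - z0| <= D * expR (2 * L * t)) ->
    forall t : R, 0 <= t <= 1 -> `|F (v t)| <= K.
  move=> vc hv t t01; rewrite -(subrK (F z0) (F (v t))).
  apply: le_trans (ler_normD _ _) _.
  rewrite /K mulrDl mul1r addrC lerD2l; apply: le_trans (FL _ _) _.
  rewrite -mulrA ler_wpM2l // mulrC; apply: le_trans (hv t t01) _.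
  rewrite ler_wpM2l // ler_expR ler_piMr ?mulr_ge0 //.
  by case/andP: t01.
have inv k : [/\ continuous (w k),
    (forall t : R, 0 <= t <= 1 -> `|w k t - z0| <= D * expR (2 * L * t)) &
    (forall t s : R, `|w k t - w k s| <= K * `|t - s|)].
  elim: k => [|k [wc hb hl]].
    split; first exact: cst_continuous.
    - by move=> t _; rewrite /w /= subrr normr0 mulr_ge0 ?expR_ge0.
    - by move=> t s; rewrite /w /= subrr normr0 mulr_ge0.
  have hlip := picard_step_lip wc K0 (FK _ wc hb).
  split; [exact: lip_continuous hlip|exact: picard_step_ball|exact: hlip].
have wc k : continuous (w k) by case: (inv k).
have hd k (t : R) : 0 <= t <= 1 -> `|w k.+1 t - w k t| <= D / 2 ^+ k * expR (2 * L * t).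
  elim: k t => [|k IH] t t01.
    by rewrite expr0 divr1; case: (inv 1%N) => _ /(_ t t01).
  rewrite exprSr invfM mulrA; apply: (@picard_step_contract (w k.+1) (w k)) => //.
  by rewrite divr_ge0 // exprn_ge0.
have wcl k t : w k (clamp t) = w k t.
  case: k => [//|k]; rewrite /w /= /picard_step clamp_id //; exact: clamp_itv.
pose E := D * expR (2 * L).
have E0 : 0 <= E by rewrite mulr_ge0 ?expR_ge0.
have hdE k t : `|w k.+1 t - w k t| <= E / 2 ^+ k.
  rewrite -wcl -(wcl k); have c01 := clamp_itv t.
  apply: le_trans (hd k _ c01) _; rewrite /E mulrAC.
  rewrite ler_wpM2r ?invr_ge0 ?exprn_ge0 // ler_wpM2l // ler_expR.
  by rewrite ler_piMr ?mulr_ge0 //; case/andP: c01.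
have lim t : exists l : 'rV[R]_n, forall k, `|w k t - l| <= 2 * E / 2 ^+ k.
  have /choice[l hl] : forall j, exists l, forall k, `|w k t ord0 j - l| <= 2 * E / 2 ^+ k.
    move=> j; apply: geometric_cauchy => k.
    apply: le_trans (hdE k t); have := coord_le_norm (w k.+1 t - w k t) j.
    by rewrite !mxE.
  exists (\row_j l j) => k; apply: norm_le_coord.
    by rewrite divr_ge0 ?exprn_ge0 ?mulr_ge0.
  by move=> j; rewrite !mxE.
have /choice[v hv] := lim.
have vlip t s : `|v t - v s| <= K * `|t - s|.
  rewrite -subr_le0; apply: (@le_pow2_le0 R _ (4 * E)) => k.
  rewrite lerBlDr -(subrKA (w k t)) -(subrKA (w k s) (w k t)).
  apply: le_trans (ler_normD _ _) _.
  apply: le_trans (lerD (lexx _) (ler_normD _ _)) _.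
  have := hv t k; rewrite distrC => h1; have h2 := hv s k.
  case: (inv k) => _ _ /(_ t s) h3.
  apply: le_trans (lerD h1 (lerD h3 h2)) _.
  by rewrite le_eqVlt; apply/orP; left; apply/eqP; lra.
have vc : continuous v by exact: lip_continuous vlip.
have fixv (t : R) : 0 <= t <= 1 -> picard_step v t = v t.
  move=> t01; apply/eqP; rewrite -subr_eq0 -normr_le0.
  apply: (@le_pow2_le0 R _ (2 * E * expR (2 * L))) => k.
  have H : `|picard_step v t - w k.+1 t| <= E / 2 ^+ k * expR (2 * L).
    have := @picard_step_contract v (w k) (2 * E / 2 ^+ k) vc (wc k) _ _ t t01.
    move=> /(_ _ _)/le_trans; apply.
    - by rewrite divr_ge0 ?exprn_ge0 ?mulr_ge0.
    - move=> s /andP[s0 _]; rewrite distrC; apply: le_trans (hv s k) _.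
      rewrite ler_peMr ?divr_ge0 ?exprn_ge0 ?mulr_ge0 //.
      by rewrite -[leLHS]expR0 ler_expR !mulr_ge0.
    - rewrite (_ : 2 * E / 2 ^+ k / 2 = E / 2 ^+ k); last by field; rewrite expf_neq0.
      rewrite ler_wpM2l ?divr_ge0 ?exprn_ge0 // ler_expR ler_piMr ?mulr_ge0 //.
      by case/andP: t01.
  rewrite -(subrKA (w k.+1 t)); apply: le_trans (ler_normD _ _) _.
  apply: le_trans (lerD H (hv t k.+1)) _.
  rewrite (_ : 2 * E / 2 ^+ k.+1 = E / 2 ^+ k); last first.
    by rewrite exprS; field; rewrite expf_neq0.
  rewrite (_ : 2 * E * _ / _ = E / 2 ^+ k * expR (2 * L) + E / 2 ^+ k * expR (2 * L)); last by ring.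
  rewrite lerD2l ler_peMr ?divr_ge0 ?exprn_ge0 //.
  by rewrite -[leLHS]expR0 ler_expR mulr_ge0.
have vball (t : R) : 0 <= t <= 1 -> `|v t - z0| <= D * expR (2 * L * t).
  move=> t01; rewrite -subr_le0; apply: (@le_pow2_le0 R _ (2 * E)) => k.
  rewrite lerBlDr -(subrKA (w k t)); apply: le_trans (ler_normD _ _) _.
  have := hv t k; rewrite distrC => h1; case: (inv k) => _ /(_ t t01) h2 _.
  exact: lerD h1 h2.
have slip := picard_step_lip vc K0 (FK _ vc vball).
pose W t : 'rV[R]_n := z0 + \row_j primitive (fun s => F (v s) ord0 j) t.
have Wv (t : R) : 0 <= t <= 1 -> W t = v t.
  by move=> t01; rewrite -fixv // /W /picard_step clamp_id.
exists W; split.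
- by rewrite Wv ?lexx ?ler01 // -fixv ?lexx ?ler01 // picard_step0.
- move=> t t01; rewrite Wv //; apply: is_derive_coordP => j.
  apply: (@near_is_derive R R^o (fun s => z0 ord0 j + primitive (fun s => F (v s) ord0 j) s)).
    by near=> s; rewrite !mxE.
  rewrite -[F (v t) ord0 j]add0r; apply: is_deriveD.
  apply: is_derive_primitive; first exact: comp_coord_continuous.
  by case/andP: t01 => t0 _; apply: lt_le_trans t0.
- move=> t /andP[t0 t1]; rewrite Wv ?t0 // -fixv ?t0 //.
  by have := slip t 0; rewrite picard_step0 subr0 (ger0_norm t0).
Unshelve. all: by end_near. Qed.

End picard.

(** * The Hamiltonian flow and its integrator *)

Section flow.
Variables (R : realType) (d : nat).
Implicit Types (z w : 'rV[R]_d * 'rV[R]_d).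

(** The flow is obtained in [R^(2d)] as a space of row vectors, where coordinates
are available, and is carried back to pairs. *)
Definition vec z : 'rV[R]_(d + d) := row_mx z.1 z.2.
Definition unvec (v : 'rV[R]_(d + d)) : 'rV[R]_d * 'rV[R]_d := (lsubmx v, rsubmx v).

Lemma vecK : cancel vec unvec.
Proof. by case=> a b; rewrite /unvec row_mxKl row_mxKr. Qed.

Lemma vecB z w : vec (z - w) = vec z - vec w.
Proof. by rewrite /vec opp_row_mx add_row_mx. Qed.

Lemma norm_vec z : `|vec z| <= `|z|.
Proof.
apply: norm_le_coord => // j; rewrite mxE; case: splitP => k _.
  exact: le_trans (coord_le_norm _ _) (norm_fst z).
exact: le_trans (coord_le_norm _ _) (norm_snd z).
Qed.

Lemma norm_unvec (v : 'rV[R]_(d + d)) : `|unvec v| <= `|v|.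
Proof.
by apply: norm_pair; apply: norm_le_coord => // j; rewrite mxE; exact: coord_le_norm.
Qed.

Lemma unvecB (v w : 'rV[R]_(d + d)) : unvec (v - w) = unvec v - unvec w.
Proof. by rewrite /unvec !raddfB. Qed.

Lemma norm_le_pnorm z : `|z| <= pnorm z.
Proof.
apply: le_trans (norm_le_enorm (vec z)).
by rewrite -{1}(vecK z); exact: norm_unvec.
Qed.

Lemma pnorm_le_norm z : pnorm z <= (d + d)%:R * `|z|.
Proof. by apply: le_trans (enorm_le_norm (vec z)) _; rewrite ler_wpM2l // norm_vec. Qed.

Definition ham_field H z : 'rV[R]_d * 'rV[R]_d := (dHp H z, - dHx H z).

Lemma lipschitz_norm (L : R) F : 0 <= L -> lipschitz_with L F ->
  forall z w, `|F z - F w| <= L * (d + d)%:R * `|z - w|.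
Proof.
move=> L0 FL z w; apply: le_trans (norm_le_enorm _) _.
by apply: le_trans (FL z w) _; rewrite -mulrA ler_wpM2l // pnorm_le_norm.
Qed.

Lemma is_derive_coord n (f : R -> 'rV[R]_n) (df : 'rV[R]_n) (t : R) j :
  is_derive t 1 f df -> is_derive t 1 (fun s => f s ord0 j) (df ord0 j).
Proof.
move=> [fD <-]; apply: DeriveDef; first by move/derivable_mxP : fD.
by rewrite derive_mx // mxE.
Qed.

Variables (H : 'rV[R]_d -> 'rV[R]_d -> R) (L : R).
Hypothesis L0 : 0 <= L.
Hypothesis fieldL : forall z w, `|ham_field H z - ham_field H w| <= L * `|z - w|.

(** Because the last two bounds are proportional to the field at the initial point,
which grows at most linearly, the constants of the integrator are uniform on balls. *)
Lemma hamiltonian_flow z0 : exists w : R -> 'rV[R]_d * 'rV[R]_d,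
  [/\ w 0 = z0,
      forall h : R, 0 < h <= 1 -> hamiltonian_solution H h w,
      forall h : R, 0 <= h <= 1 ->
        `|w h - z0| <= (1 + L * expR (2 * L)) * `|ham_field H z0| * h &
      forall h : R, 0 <= h <= 1 ->
        `|w h - z0 - h *: ham_field H z0|
          <= L * (1 + L * expR (2 * L)) * `|ham_field H z0| * h ^+ 2].
Proof.
pose F v := vec (ham_field H (unvec v)).
have FL x y : `|F x - F y| <= L * `|x - y|.
  rewrite -vecB; apply: le_trans (norm_vec _) _; apply: le_trans (fieldL _ _) _.
  by rewrite ler_wpM2l // -unvecB norm_unvec.
have [v [v0 vD vb]] := picard_lindelof (vec z0) L0 FL.
have Fv0 : `|F (vec z0)| <= `|ham_field H z0| by rewrite /F vecK norm_vec.
pose C := 1 + L * expR (2 * L).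
have C0 : 0 <= C by rewrite addr_ge0 // mulr_ge0 // expR_ge0.
have vb' t : 0 <= t <= 1 -> `|v t - vec z0| <= C * `|ham_field H z0| * t.
  move=> t01; apply: le_trans (vb t t01) _.
  by rewrite ler_wpM2r ?ler_wpM2l //; case/andP: t01.
exists (unvec \o v); split => /=.
- by rewrite v0 vecK.
- move=> h /andP[h0 h1]; split.
    apply: continuous_in_subspaceT => t; rewrite inE /= in_itv /= => /andP[t0 th].
    have vc : {for t, continuous v}.
      apply: differentiable_continuous; apply/derivable1_diffP.
      by have := vD t; rewrite t0 (le_trans th h1) => /(_ isT) [].
    apply: continuous_comp; first exact: vc.
    apply: (@lip_continuous _ _ _ _ 1) => x y.
    by rewrite mul1r -unvecB norm_unvec.
  move=> t; rewrite in_itv /= => /andP[t0 th].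
  have := vD t; rewrite (ltW t0) (le_trans (ltW th) h1) => /(_ isT) D.
  split; apply: is_derive_coordP => j.
    have := is_derive_coord (lshift d j) D; rewrite /F /vec row_mxEl /=.
    by apply: near_is_derive; near=> s; rewrite mxE.
  have := is_derive_coord (rshift d j) D; rewrite /F /vec row_mxEr /=.
  by apply: near_is_derive; near=> s; rewrite mxE.
- move=> h h01; rewrite -{1}(vecK z0) -unvecB.
  exact: le_trans (norm_unvec _) (vb' _ h01).
- move=> h /andP[h0 h1].
  have -> : unvec (v h) - z0 - h *: ham_field H z0
      = unvec (v h - vec z0 - h *: F (vec z0)).
    rewrite /F vecK !unvecB vecK; congr (_ - _).
    by rewrite /unvec /vec !linearZ /= row_mxKl row_mxKr.
  apply: le_trans (norm_unvec _) _.
  apply: norm_le_coord; first by rewrite !mulr_ge0 ?exprn_ge0.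
  move=> j.
  have E (a b c : 'rV[R]_(d + d)) : (a - b - h *: c) ord0 j = a ord0 j - b ord0 j - h * c ord0 j.
    by rewrite !mxE.
  rewrite {}E.
  pose g s := v s ord0 j - F (vec z0) ord0 j * s.
  have -> : v h ord0 j - vec z0 ord0 j - h * F (vec z0) ord0 j = g h - g 0.
    by rewrite /g v0 mulr0 subr0 [h * _]mulrC addrAC.
  rewrite expr2 [leRHS]mulrA.
  set K := L * _ * _ * h.
  have -> : K * h = K * h - K * 0 by rewrite mulr0 subr0.
  apply: (@mvt_bound R g (fun s => K * s)
    (fun s => F (v s) ord0 j - F (vec z0) ord0 j) (fun=> K) 0 h h0).
  + move=> t /andP[t0 th]; apply: is_deriveB.
      by apply: is_derive_coord; apply: vD; rewrite t0 (le_trans th h1).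
    rewrite -[X in is_derive _ _ _ X]mulr1; exact: is_deriveZ.
  + by move=> t _; rewrite -[X in is_derive _ _ _ X]mulr1; exact: is_deriveZ.
  + move=> t /andP[t0 th].
    have := coord_le_norm (F (v t) - F (vec z0)) j; rewrite !mxE => /le_trans; apply.
    apply: le_trans (FL _ _) _; rewrite /K -!mulrA ler_wpM2l // mulrA.
    have := vb' t; rewrite t0 (le_trans th h1) => /(_ isT) /le_trans; apply.
    by rewrite ler_wpM2l // mulr_ge0.
Unshelve. all: by end_near. Qed.

Section integrator.
Variables (Phi : R -> 'rV[R]_d * 'rV[R]_d -> 'rV[R]_d * 'rV[R]_d) (r : nat).
Hypothesis r2 : (2 <= r)%N.
Hypothesis PhiH : integrator_of_order H Phi r.

(** One step of the integrator is an Euler step up to [O(h^2)]: the exact solution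
is, and the local error [h^r] is at most [h^2] since [r >= 2]. *)
Lemma integrator_consistent (rho : R) : exists2 kappa : R, 0 <= kappa &
  forall z h, `|z| <= rho -> 0 < h <= 1 ->
    `|Phi h z - z - h *: ham_field H z| <= kappa * h ^+ 2.
Proof.
have [_ [C Cbd CP]] := PhiH.
pose A : set 'rV[R]_d := [set x | `|x| <= rho].
have Acpt : compact A by exact: compact_ball_row.
have [c cP] := Cbd _ (compact_setX Acpt Acpt).
pose D := 1 + L * expR (2 * L).
have D0 : 0 <= D by rewrite addr_ge0 // mulr_ge0 // expR_ge0.
pose B := `|ham_field H 0| + L * `|rho|.
have B0 : 0 <= B by rewrite addr_ge0 // mulr_ge0.
exists (`|c| + L * D * B); first by rewrite addr_ge0 // !mulr_ge0.
move=> z h zrho h01; have /andP[h0 h1] := h01.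
have [w [w0 wsol _ wE]] := hamiltonian_flow z.
have h01' : 0 <= h <= 1 by rewrite ltW.
rewrite mulrDl.
have -> : Phi h z - z - h *: ham_field H z
  = (Phi h z - w h) + (w h - z - h *: ham_field H z) by rewrite !addrA subrK.
apply: le_trans (ler_normD _ _) _; apply: lerD.
  apply: le_trans (norm_le_pnorm _) _.
  have := CP h w h01 (wsol h h01); rewrite w0 => /le_trans; apply.
  apply: (@le_trans _ _ (`|c| * h ^+ r)).
    apply: ler_wpM2r; first by rewrite exprn_ge0 // ltW.
    apply: le_trans (ler_norm c).
    apply: cP; split => /=.
      exact: le_trans (norm_fst z) zrho.
    exact: le_trans (norm_snd z) zrho.
  by rewrite ler_wpM2l // ler_wiXn2l // ltW.
apply: le_trans (wE h h01') _.
apply: ler_wpM2r; first by rewrite exprn_ge0 // ltW.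
rewrite ler_wpM2l ?mulr_ge0 //.
rewrite /B -(subrK (ham_field H 0) (ham_field H z)) addrC.
apply: le_trans (ler_normD _ _) _; rewrite lerD2l.
apply: le_trans (fieldL _ _) _; rewrite subr0 ler_wpM2l //.
exact: le_trans zrho (ler_norm _).
Qed.

(** Discrete Gronwall inequality.  The consistency constant is only known on a
ball, so the radius of that ball is fixed first, with room for a unit of accumulated
local errors; the step is then taken so small that these errors do not exceed 1. *)
Lemma integrator_stable (T rho0 : R) : 0 < T -> 0 <= rho0 ->
  exists rho h0 : R, 0 < h0 /\ forall (h : R) (i : nat) z,
    0 < h <= 1 -> h <= h0 -> i%:R * h <= T -> `|z| <= rho0 ->
    `|iter i (Phi h) z| <= rho.
Proof.
move=> T0 rho00; pose B := `|ham_field H 0|; pose a := L + B.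
have B0 : 0 <= B by exact: normr_ge0.
have a0 : 0 <= a by rewrite addr_ge0.
(* The value of the Gronwall bound when the accumulated local errors are at most 1. *)
pose rho := expR (a * T) * (rho0 + 2).
have [kappa k0 kP] := integrator_consistent rho.
have kT0 : 0 < kappa * T + 1 by rewrite ltr_wpDl // mulr_ge0 // ltW.
exists rho, (kappa * T + 1)^-1; split; first by rewrite invr_gt0.
move=> h i z h01 hh0 + zrho; have /andP[h0 h1] := h01.
have kh : kappa * T * h <= 1.
  apply: (@le_trans _ _ (kappa * T * (kappa * T + 1)^-1)).
    by rewrite ler_wpM2l // mulr_ge0 // ltW.
  by rewrite ler_pdivrMr // mul1r lerDl.
suff H1 : i%:R * h <= T -> `|iter i (Phi h) z| + 1
    <= expR (a * (i%:R * h)) * (rho0 + 1 + i%:R * h * (kappa * h)).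
  move=> ihT; have := H1 ihT => H2.
  apply: le_trans (_ : _ <= `|iter i (Phi h) z| + 1) _; first by rewrite lerDl.
  apply: le_trans H2 _; rewrite /rho.
  have ih0 : 0 <= i%:R * h by rewrite mulr_ge0 // ltW.
  apply: ler_pM; rewrite ?expR_ge0 //.
  - by rewrite !addr_ge0 // mulr_ge0 // mulr_ge0 // ltW.
  - by rewrite ler_expR ler_wpM2l.
  rewrite -addrA lerD2l; apply: le_trans (_ : _ <= 1 + T * (kappa * h)) _.
    by rewrite lerD2l ler_wpM2r // mulr_ge0 // ltW.
  have : T * (kappa * h) <= 1 by rewrite mulrA [T * _]mulrC.
  by lra.
elim: i => [|i IH] ihT.
  by rewrite /= !mul0r mulr0 expR0 mul1r addr0 lerD2r.
have iT : i%:R * h <= T.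
  by apply: le_trans ihT; rewrite ler_wpM2r ?ler_nat // ltW.
have {}IH := IH iT; rewrite iterS; set y := iter i (Phi h) z in IH *.
set E := expR (a * (i%:R * h)) in IH.
have ih0 : 0 <= i%:R * h by rewrite mulr_ge0 // ltW.
have E1 : 1 <= E by rewrite /E -[leLHS]expR0 ler_expR mulr_ge0.
set X := rho0 + 1 + i%:R * h * (kappa * h) in IH.
have kh0 : 0 <= kappa * h by rewrite mulr_ge0 // ltW.
have X0 : 0 <= X by rewrite /X !addr_ge0 // mulr_ge0.
have yrho : `|y| <= rho.
  apply: le_trans (_ : _ <= `|y| + 1) _; first by rewrite lerDl.
  apply: le_trans IH _; apply: ler_pM; rewrite ?expR_ge0 //.
    by rewrite ler_expR ler_wpM2l.
  rewrite /X -addrA lerD2l; apply: le_trans (_ : _ <= 1 + T * (kappa * h)) _.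
    by rewrite lerD2l ler_wpM2r.
  have : T * (kappa * h) <= 1 by rewrite mulrA [T * _]mulrC.
  by lra.
have step : `|Phi h y| <= `|y| + h * (B + L * `|y|) + kappa * h ^+ 2.
  have -> : Phi h y = y + h *: ham_field H y + (Phi h y - y - h *: ham_field H y).
    by rewrite [RHS]addrC -(addrA (Phi h y)) -opprD subrK.
  apply: le_trans (ler_normD _ _) _; apply: lerD; last exact: kP.
  apply: le_trans (ler_normD _ _) _; rewrite lerD2l normrZ gtr0_norm //.
  apply: ler_wpM2l; first exact: ltW.
  rewrite -(subrK (ham_field H 0) (ham_field H y)).
  apply: le_trans (ler_normD _ _) _; rewrite addrC lerD2l.
  by apply: le_trans (fieldL _ _) _; rewrite subr0.
have ah : 1 + a * h <= expR (a * h) by exact: expR_ge1Dx.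
have -> : i.+1%:R * h = i%:R * h + h by rewrite -addn1 natrD mulrDl mul1r.
rewrite [a * (_ + h)]mulrDr expRD -/E.
have -> : rho0 + 1 + (i%:R * h + h) * (kappa * h) = X + h * (kappa * h).
  by rewrite /X mulrDl addrA.
apply: le_trans (_ : _ <= (1 + a * h) * (`|y| + 1) + kappa * h ^+ 2) _.
  apply: le_trans (lerD step (lexx 1)) _; rewrite /a.
  have y0 : 0 <= `|y| by [].
  have := mulr_ge0 (ltW h0) (mulr_ge0 B0 y0).
  have := mulr_ge0 (ltW h0) L0.
  move=> ? ?; nra.
apply: le_trans (_ : _ <= expR (a * h) * (E * X) + (E * expR (a * h)) * (h * (kappa * h))) _.
  apply: lerD.
    by apply: ler_pM => //; rewrite addr_ge0 // mulr_ge0 // ltW.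
  have -> : kappa * h ^+ 2 = h * (kappa * h) by ring.
  apply: ler_peMl; first by rewrite mulr_ge0 // ltW.
  rewrite -[leLHS]mul1r; apply: ler_pM => //.
  by rewrite -[leLHS]expR0 ler_expR mulr_ge0 // ltW.
by rewrite le_eqVlt; apply/orP; left; apply/eqP; ring.
Qed.

Lemma iter_continuous (h : R) (i : nat) : 0 < h <= 1 -> continuous (iter i (Phi h)).
Proof.
move=> h01; have [Pc _] := PhiH.
elim: i => [|i IH] z; first exact: cvg_id.
by apply: (@continuous_comp _ _ _ (iter i (Phi h)) (Phi h)); [exact: IH|exact: Pc].
Qed.

(** Small steps are covered by [integrator_stable].  Only finitely many numbers of
steps [M] are left, and for each of them the trajectories are continuous images of a
compact set. *)
Lemma integrator_bounded (T : R) (K : set ('rV[R]_d * 'rV[R]_d)) :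
  0 < T -> compact K ->
  exists2 rho : R, 0 <= rho & forall (M : nat) (i : nat) z, T <= M%:R -> (i <= M)%N -> K z ->
    `|iter i (Phi (T / M%:R)) z| <= rho.
Proof.
move=> T0 Kcpt.
have bnd (f : 'rV[R]_d * 'rV[R]_d -> 'rV[R]_d * 'rV[R]_d) : continuous f ->
    exists2 rho : R, 0 <= rho & forall z, K z -> `|f z| <= rho.
  move=> fc; have : compact (f @` K).
    by apply: continuous_compact => //; exact: continuous_subspaceT.
  move=> /compact_bounded[a [_ ha]]; exists (`|a| + 1); first by rewrite addr_ge0.
  move=> z Kz; apply: (ha (`|a| + 1)); last by exists z.
  by rewrite ltr_pwDr // ler_norm.
have M01 (M : nat) : T <= M%:R -> 0 < T / M%:R <= 1.
  move=> TM; have M0 : 0 < M%:R :> R by apply: lt_le_trans TM.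
  by rewrite divr_gt0 //= ler_pdivrMr // mul1r.
have fin n : exists2 rho : R, 0 <= rho & forall (M i : nat) z, (M < n)%N -> T <= M%:R ->
    (i <= M)%N -> K z -> `|iter i (Phi (T / M%:R)) z| <= rho.
  elim: n => [|n [rho rho0 IH]]; first by exists 0.
  have [rho' rho'0 h'] : exists2 rho' : R, 0 <= rho' & forall (i : nat) z, T <= n%:R ->
      (i <= n)%N -> K z -> `|iter i (Phi (T / n%:R)) z| <= rho'.
    have [Tn|Tn] := leP T n%:R; last by exists 0.
    have : forall k, exists2 rho' : R, 0 <= rho' & forall (i : nat) z,
        (i < k)%N -> K z -> `|iter i (Phi (T / n%:R)) z| <= rho'.
      elim=> [|k [a a0 ha]]; first by exists 0.
      have [b b0 hb] := bnd _ (@iter_continuous _ k (M01 _ Tn)).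
      exists (Num.max a b); first by rewrite le_max a0.
      move=> i z; rewrite ltnS leq_eqVlt => /predU1P[->|ik] Kz; rewrite le_max.
        by rewrite hb ?orbT.
      by rewrite ha.
    by move=> /(_ n.+1)[a a0 ha]; exists a => // i z _ ? ?; exact: ha.
  exists (Num.max rho rho'); first by rewrite le_max rho0.
  move=> M i z; rewrite ltnS leq_eqVlt => /predU1P[->|Mn] TM iM Kz; rewrite le_max.
    by rewrite h' ?orbT.
  by rewrite IH.
have [rho0 rho00 hK] := bnd id (fun x => cvg_id).
have [rho [h0 [h00 hs]]] := integrator_stable T0 rho00.
pose n := (Num.truncn (T / h0)).+1.
have [rho' rho'0 hf] := fin n.
exists (Num.max rho' `|rho|); first by rewrite le_max rho'0.
move=> M i z TM iM Kz; rewrite le_max; have [Mn|nM] := ltnP M n.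
  by rewrite hf.
have M0 : 0 < M%:R :> R by apply: lt_le_trans TM.
apply/orP; right; apply: le_trans (ler_norm rho); apply: hs.
- exact: M01.
- rewrite ler_pdivrMr // -ler_pdivrMl // mulrC.
  apply: ltW; apply: lt_le_trans (_ : n%:R <= _); last by rewrite ler_nat.
  by rewrite /n truncnS_gt.
- rewrite mulrCA ger_pMr // ler_pdivrMr // mul1r ler_nat //.
- exact: hK.
Qed.

End integrator.
End flow.

(** * Differential calculus in several variables *)

Section calculus.
Variables (R : realType) (V : normedModType R).
Implicit Types (x y v w : V) (f : V -> R).

Lemma is_derive_line f x v (t : R) : differentiable f (x + t *: v) ->
  is_derive t 1 (fun s : R => f (x + s *: v)) ('D_v f (x + t *: v)).
Proof.
move=> df; have E : (fun h : R => h^-1 *: (f (x + (h *: 1 + t) *: v) - f (x + t *: v)))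
    = (fun h : R => h^-1 *: (f (h *: v + (x + t *: v)) - f (x + t *: v))).
  apply/funext => h; congr (_ *: (f _ - _)).
  have -> : h *: (1 : R^o) = h :> R by rewrite /GRing.scale /= mulr1.
  by rewrite scalerDl addrCA.
have /diff_derivable - /(_ v) dv := df.
by apply: DeriveDef; rewrite /derivable /derive /= E.
Qed.

Lemma mvt_line f x v (s : R) : (forall y, differentiable f y) -> 0 <= s ->
  exists2 t : R, 0 <= t <= s & f (x + s *: v) - f x = s * 'D_v f (x + t *: v).
Proof.
move=> df s0.
have D (t : R) : is_derive t 1 (fun s : R => f (x + s *: v)) ('D_v f (x + t *: v)).
  exact: is_derive_line.
have [|t] := @MVT_segment R (fun t => f (x + t *: v)) (fun t => 'D_v f (x + t *: v)) 0 s s0.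
  by apply: derivable_within_continuous => t _; case: (D t).
rewrite in_itv /= => t01 E; exists t => //.
by move: E; rewrite scale0r addr0 subr0 mulrC.
Qed.

(** The second difference of [f] over a small parallelogram is a mixed second
derivative at some point of it; exchanging the sides exchanges the order of
differentiation. *)
Lemma mvt_rectangle f v w x (s : R) : Ck 2 f -> 0 <= s ->
  exists a b : R, [/\ 0 <= a <= s, 0 <= b <= s &
    f (x + s *: v + s *: w) - f (x + s *: v) - f (x + s *: w) + f x
      = s ^+ 2 * 'D_w (fun y => 'D_v f y) (x + a *: v + b *: w)].
Proof.
move=> [df ddf] s0; have [dvf _] := ddf v.
pose g y := f (y + s *: w) - f y.
have dg y : differentiable g y.
  apply: differentiableB; last exact: df.
  apply: (@differentiable_comp _ _ _ _ (fun y => y + s *: w)); last exact: df.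
  by apply: differentiableD => //; exact: differentiable_cst.
have [a a01 Ea] := mvt_line x v dg s0.
have Dg y : 'D_v g y = 'D_v f (y + s *: w) - 'D_v f y.
  have shift : is_derive y v (fun y => f (y + s *: w)) ('D_v f (y + s *: w)).
    have E : (fun h : R => h^-1 *: (f (h *: v + y + s *: w) - f (y + s *: w)))
      = (fun h : R => h^-1 *: (f (h *: v + (y + s *: w)) - f (y + s *: w))).
      by apply/funext => h; rewrite addrA.
    have /diff_derivable - /(_ v) dv := df (y + s *: w).
    by apply: DeriveDef; rewrite /derivable /derive /= E.
  have dfy : derivable f y v by exact: diff_derivable.
  have -> : g = (fun y => f (y + s *: w)) - f by [].
  by case: shift => ds <-; rewrite (deriveB ds dfy).
have [b b01 Eb] := mvt_line (x + a *: v) w dvf s0.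
exists a, b; split => //.
rewrite Dg Eb mulrA -expr2 in Ea; rewrite -Ea /g.
by ring.
Qed.

(** Schwarz's theorem: both mixed derivatives are limits of the same second
difference. *)
Lemma derive_comm f v w x : Ck 2 f ->
  'D_v (fun y => 'D_w f y) x = 'D_w (fun y => 'D_v f y) x.
Proof.
move=> f2; have [_ ddf] := f2.
have [_ /(_ v) cA] := ddf w; have [_ /(_ w) cB] := ddf v.
set A := fun y => 'D_v _ y in cA; set B := fun y => 'D_w _ y in cB.
rewrite -/(A x) -/(B x).
apply/eqP; rewrite -subr_eq0 -normr_le0; apply/ler_addgt0Pr => e e0; rewrite add0r.
have e2 : 0 < e / 2 by rewrite divr_gt0.
have [r1 /= r10 hA] : exists2 r : R, 0 < r & forall y, `|x - y| < r -> `|A x - A y| < e / 2.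
  have /cvgrPdist_lt/(_ _ e2)/nbhs_ballP[r /= r0 hr] := cA x.
  by exists r => // y; rewrite -ball_normE in hr; exact: hr.
have [r3 /= r30 hB] : exists2 r : R, 0 < r & forall y, `|x - y| < r -> `|B x - B y| < e / 2.
  have /cvgrPdist_lt/(_ _ e2)/nbhs_ballP[r /= r0 hr] := cB x.
  by exists r => // y; rewrite -ball_normE in hr; exact: hr.
pose K := `|v| + `|w| + 1.
have K0 : 0 < K by rewrite ltr_wpDl // addr_ge0.
pose r := Num.min r1 r3; have r0 : 0 < r by rewrite lt_min r10.
pose s := r / (2 * K); have s0 : 0 < s by rewrite divr_gt0 // mulr_gt0.
have close a b : 0 <= a <= s -> 0 <= b <= s -> forall v' w', `|v'| + `|w'| <= K ->
    `|x - (x + a *: v' + b *: w')| < r.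
  move=> /andP[a0 as_] /andP[b0 bs] v' w' vw.
  rewrite -addrA opprD addrA subrr add0r normrN.
  apply: le_lt_trans (ler_normD _ _) _; rewrite !normrZ !ger0_norm //.
  apply: (@le_lt_trans _ _ (s * K)).
    apply: le_trans (ler_wpM2l (ltW s0) vw); rewrite mulrDr.
    by apply: lerD; exact: ler_wpM2r.
  by rewrite /s invfM mulrA -mulrA mulVf ?gt_eqF // mulr1 ltr_pdivrMr // ltr_pMr // ltr1n.
have [a [b [a0 b0 E1]]] := mvt_rectangle v w x f2 (ltW s0).
have [a' [b' [a0' b0' E2]]] := mvt_rectangle w v x f2 (ltW s0).
have AB : A (x + a' *: w + b' *: v) = B (x + a *: v + b *: w).
  have s2 : s ^+ 2 != 0 by rewrite expf_neq0 // gt_eqF.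
  apply: (mulfI s2); apply: etrans (esym E2) _; apply: etrans E1.
  by rewrite (addrAC x (s *: w)); ring.
rewrite -(subrKA (A (x + a' *: w + b' *: v))).
apply: le_trans (ler_normD _ _) _.
rewrite [e]splitr; apply: lerD.
  apply: ltW; apply: hA; apply: lt_le_trans (_ : r <= r1); last by rewrite ge_min lexx.
  by apply: (close a' b' a0' b0' w v); rewrite [_ + `|v|]addrC lerDl.
rewrite AB distrC; apply: ltW; apply: hB; apply: lt_le_trans (_ : r <= r3); last by rewrite ge_min lexx orbT.
by apply: (close a b a0 b0 v w); rewrite lerDl.
Qed.

(** A form of finite dimensionality that holds for products of spaces of row
vectors without choosing an isomorphism with a coordinate space. *)
Definition bounded_basis (I : finType) (e : I -> V) := forall v,
  exists2 c : I -> R, v = \sum_i c i *: e i & forall i, `|c i| <= `|v|.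

(** Being Lipschitz on every ball is stable under the operations from which the
residual gradient is built, and gives at once its continuity, its bounds on balls and
its dependence on the parameter. *)
Definition ball_lipschitz (W : normedModType R) (f : V -> W) := forall rho : R,
  exists2 C : R, 0 <= C & forall x y, `|x| <= rho -> `|y| <= rho ->
    `|f x - f y| <= C * `|x - y|.

Lemma ball_lipschitz_bounded (W : normedModType R) (f : V -> W) : ball_lipschitz f ->
  forall rho : R, exists2 C : R, 0 <= C & forall x, `|x| <= rho -> `|f x| <= C.
Proof.
move=> fl rho; have [C C0 h] := fl `|rho|.
exists (`|f 0| + C * `|rho|); first by rewrite addr_ge0 // mulr_ge0.
move=> x xr; have xr' := le_trans xr (ler_norm rho).
rewrite -(subrK (f 0) (f x)) addrC; apply: le_trans (ler_normD _ _) _; rewrite lerD2l.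
apply: le_trans (h x 0 xr' _) _; first by rewrite normr0.
by rewrite subr0 ler_wpM2l.
Qed.

Lemma ball_lipschitz_continuous (W : normedModType R) (f : V -> W) :
  ball_lipschitz f -> continuous f.
Proof.
move=> fl x; have [C C0 h] := fl (`|x| + 1).
apply/cvgrPdist_le => e e0; near=> y.
have xy : `|x - y| <= Num.min 1 (e / (C + 1)).
  near: y; apply/nbhs_ballP; exists (Num.min 1 (e / (C + 1))) => /=.
    by rewrite lt_min ltr01 divr_gt0 // ltr_wpDl.
  by move=> y; rewrite -ball_normE /= => /ltW.
move: xy; rewrite le_min => /andP[xy1 xy2].
apply: le_trans (h x y _ _) _.
- by rewrite lerDl.
- rewrite -(subrK x y) addrC; apply: le_trans (ler_normD _ _) _.
  by rewrite lerD2l distrC.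
apply: (@le_trans _ _ ((C + 1) * `|x - y|)); first by rewrite ler_wpM2r // lerDl.
by rewrite mulrC -ler_pdivlMr // ltr_wpDl.
Unshelve. all: by end_near. Qed.

Lemma ball_lipschitzD (W : normedModType R) (f g : V -> W) :
  ball_lipschitz f -> ball_lipschitz g -> ball_lipschitz (fun x => f x + g x).
Proof.
move=> fl gl rho; have [C C0 h] := fl rho; have [D D0 k] := gl rho.
exists (C + D) => [|x y xr yr]; first exact: addr_ge0.
rewrite opprD addrACA mulrDl; apply: le_trans (ler_normD _ _) _.
by apply: lerD; [exact: h|exact: k].
Qed.

Lemma ball_lipschitz_cst (W : normedModType R) (a : W) : ball_lipschitz (fun=> a).
Proof. by move=> rho; exists 0 => // x y _ _; rewrite subrr normr0 mul0r. Qed.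

Lemma ball_lipschitz_sum (I : Type) (s : seq I) (f : I -> V -> R) :
  (forall i, ball_lipschitz (f i)) -> ball_lipschitz (fun x => \sum_(i <- s) f i x).
Proof.
move=> fl; elim: s => [|i s IH].
  rewrite (_ : (fun _ => _) = fun=> 0); first exact: ball_lipschitz_cst.
  by apply/funext => y; rewrite big_nil.
rewrite (_ : (fun _ => _) = (fun y => f i y + \sum_(j <- s) f j y)).
  exact: ball_lipschitzD.
by apply/funext => y; rewrite big_cons.
Qed.

Lemma ball_lipschitzM f g :
  ball_lipschitz f -> ball_lipschitz g -> ball_lipschitz (fun x => f x * g x).
Proof.
move=> fl gl rho; have [C C0 h] := fl rho; have [D D0 k] := gl rho.
have [A A0 hA] := ball_lipschitz_bounded fl rho.
have [B B0 hB] := ball_lipschitz_bounded gl rho.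
exists (C * B + A * D) => [|x y xr yr]; first by rewrite addr_ge0 // mulr_ge0.
have -> : f x * g x - f y * g y = (f x - f y) * g x + f y * (g x - g y) by ring.
rewrite [leRHS]mulrDl; apply: le_trans (ler_normD _ _) _; rewrite !normrM; apply: lerD.
  by rewrite mulrAC; apply: ler_pM => //; [exact: h|exact: hB].
by rewrite -mulrA; apply: ler_pM => //; [exact: hA|exact: k].
Qed.

Lemma ball_lipschitz_comp (W W' : normedModType R) (f : V -> W) (G : W -> W') (K : R) :
  (forall x y : W, `|G x - G y| <= K * `|x - y|) -> ball_lipschitz f ->
  ball_lipschitz (fun x => G (f x)).
Proof.
move=> GK fl rho; have [C C0 h] := fl rho.
exists (`|K| * C) => [|x y xr yr]; first by rewrite mulr_ge0.
apply: le_trans (GK _ _) _; rewrite -mulrA.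
apply: le_trans (ler_wpM2r (normr_ge0 _) (ler_norm K)) _.
by rewrite ler_wpM2l // h.
Qed.

Lemma ball_lipschitz_pair (W W' : normedModType R) (f : V -> W) (g : V -> W') :
  ball_lipschitz f -> ball_lipschitz g -> ball_lipschitz (fun x => (f x, g x)).
Proof.
move=> fl gl rho; have [C C0 h] := fl rho; have [D D0 k] := gl rho.
exists (C + D) => [|x y xr yr]; first exact: addr_ge0.
rewrite mulrDl; apply: norm_pair => /=.
  by apply: le_trans (h x y xr yr) _; rewrite lerDl mulr_ge0.
by apply: le_trans (k x y xr yr) _; rewrite lerDr mulr_ge0.
Qed.

Lemma ball_lipschitz_row n (f : 'I_n -> V -> R) :
  (forall i, ball_lipschitz (f i)) -> ball_lipschitz (fun x => \row_i f i x : 'rV[R]_n).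
Proof.
move=> fl rho.
have /choice[C hC] : forall i, exists C : R, 0 <= C /\ forall x y, `|x| <= rho -> `|y| <= rho ->
    `|f i x - f i y| <= C * `|x - y|.
  by move=> i; have [C C0 h] := fl i rho; exists C.
have C0 i : 0 <= C i by case: (hC i).
exists (\sum_i C i) => [|x y xr yr]; first exact: sumr_ge0.
apply: norm_le_coord; first by rewrite mulr_ge0 // sumr_ge0.
move=> j; rewrite !mxE; case: (hC j) => _ /(_ x y xr yr)/le_trans; apply.
by rewrite ler_wpM2r // (bigD1 j) //= lerDl sumr_ge0.
Qed.

Lemma ball_lipschitz_lip (W : normedModType R) (f : V -> W) (K : R) :
  0 <= K -> (forall x y : V, `|f x - f y| <= K * `|x - y|) -> ball_lipschitz f.
Proof. by move=> K0 h rho; exists K. Qed.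

Lemma ball_lipschitz_coord n (f : V -> 'rV[R]_n) j :
  ball_lipschitz f -> ball_lipschitz (fun x => f x ord0 j).
Proof.
apply: (@ball_lipschitz_comp _ _ _ (fun v : 'rV[R]_n => v ord0 j) 1) => x y.
by rewrite mul1r; have := coord_le_norm (x - y) j; rewrite !mxE.
Qed.

Section compact_balls.
Hypothesis ball_cpt : forall rho : R, compact [set x : V | `|x| <= rho].
Variables (I : finType) (e : I -> V).
Hypothesis eB : bounded_basis e.

Lemma continuous_ball_bounded f (rho : R) : continuous f ->
  exists2 B : R, 0 <= B & forall x, `|x| <= rho -> `|f x| <= B.
Proof.
move=> fc; have : compact (f @` [set x : V | `|x| <= rho]).
  by apply: continuous_compact => //; exact: continuous_subspaceT.
move=> /compact_bounded[a [_ ha]]; exists (`|a| + 1); first by rewrite addr_ge0.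
move=> x xr; apply: (ha (`|a| + 1)); last by exists x.
by rewrite ltr_pwDr // ler_norm.
Qed.

Lemma derive_basis f x v (c : I -> R) : differentiable f x -> v = \sum_i c i *: e i ->
  'D_v f x = \sum_i c i * 'D_(e i) f x.
Proof.
move=> df ->; rewrite deriveE // linear_sum; apply: eq_bigr => i _.
by rewrite linearZ deriveE.
Qed.

Lemma segment_ball x y (rho t : R) : `|x| <= rho -> `|y| <= rho -> 0 <= t <= 1 ->
  `|x + t *: (y - x)| <= rho.
Proof.
move=> xr yr /andP[t0 t1].
have -> : x + t *: (y - x) = (1 - t) *: x + t *: y.
  by rewrite scalerBl scale1r scalerBr -addrA [- _ + _]addrC.
apply: le_trans (ler_normD _ _) _; rewrite !normrZ (ger0_norm t0) ger0_norm ?subr_ge0 //.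
have -> : rho = (1 - t) * rho + t * rho by ring.
by apply: lerD; apply: ler_wpM2l => //; rewrite subr_ge0.
Qed.

Lemma mvt_segment f x y : (forall z, differentiable f z) ->
  exists2 t : R, 0 <= t <= 1 & f y - f x = 'D_(y - x) f (x + t *: (y - x)).
Proof.
move=> df; have [t t01] := mvt_line x (y - x) df ler01.
by rewrite scale1r (addrC x (y - x)) subrK mul1r => E; exists t.
Qed.

Lemma Ck1_ball_lipschitz f : Ck 1 f -> ball_lipschitz f.
Proof.
move=> [df cf] rho.
have /choice[B hB] : forall i, exists B : R, 0 <= B /\ forall x, `|x| <= rho ->
    `|'D_(e i) f x| <= B.
  move=> i; have [B B0 h] := @continuous_ball_bounded (fun x => 'D_(e i) f x) rho (cf (e i)).
  by exists B.
have B0 i : 0 <= B i by case: (hB i).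
exists (\sum_i B i) => [|x y xr yr]; first exact: sumr_ge0.
rewrite distrC [X in _ <= _ * X]distrC.
have [t t01 ->] := mvt_segment x y df.
have [c vE cv] := eB (y - x).
rewrite (derive_basis _ vE) // mulr_suml; apply: le_trans (ler_norm_sum _ _ _) _.
apply: ler_sum => i _; rewrite normrM mulrC; apply: ler_pM => //.
by case: (hB i) => _; apply; exact: segment_ball.
Qed.

Lemma Ck2_taylor f : Ck 2 f -> forall rho : R, exists2 C : R, 0 <= C &
  forall x y, `|x| <= rho -> `|y| <= rho ->
    `|f y - f x - 'D_(y - x) f x| <= C * `|y - x| ^+ 2.
Proof.
move=> [df cf] rho.
have /choice[B hB] : forall i, exists B : R, 0 <= B /\ forall x y, `|x| <= rho -> `|y| <= rho ->
    `|'D_(e i) f x - 'D_(e i) f y| <= B * `|x - y|.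
  by move=> i; have [B B0 h] := Ck1_ball_lipschitz (cf (e i)) rho; exists B.
have B0 i : 0 <= B i by case: (hB i).
exists (\sum_i B i) => [|x y xr yr]; first exact: sumr_ge0.
have [t t01 ->] := mvt_segment x y df.
have [c vE cv] := eB (y - x).
rewrite !(derive_basis _ vE) // -sumrB mulr_suml; apply: le_trans (ler_norm_sum _ _ _) _.
apply: ler_sum => i _; rewrite -mulrBr normrM mulrC expr2 mulrA; apply: ler_pM => //.
case: (hB i) => _ hBi; apply: le_trans (hBi _ x (segment_ball xr yr t01) xr) _.
rewrite ler_wpM2l // addrAC subrr add0r normrZ; case/andP: t01 => t0 t1.
by rewrite ger0_norm // ler_piMl.
Qed.

End compact_balls.
End calculus.

(** * The gradient of the residual *)

(** Partial derivatives of a function of several arguments are directional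
derivatives because the difference quotients are the same functions. *)
Lemma derive_quotient (R : realType) (V W U : normedModType R) (f : V -> U) (g : W -> U) v w x y :
  (forall h : R, f (h *: v + x) - f x = g (h *: w + y) - g y) -> 'D_v f x = 'D_w g y.
Proof.
move=> E; rewrite /derive.
rewrite (_ : (fun h : R => h^-1 *: ((f \o shift x) (h *: v) - f x))
  = (fun h : R => h^-1 *: ((g \o shift y) (h *: w) - g y))) //.
by apply/funext => h /=; rewrite E.
Qed.

Lemma derive_add (R : realType) (V : normedModType R) (f g : V -> R) x v :
  differentiable f x -> differentiable g x ->
  'D_v (fun y => f y + g y) x = 'D_v f x + 'D_v g x.
Proof.
by move=> df dg; apply: (@deriveD R V R f g); exact: diff_derivable.
Qed.

Section network.
Variables (R : realType) (m d : nat).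
Notation V := ('rV[R]_m * 'rV[R]_d * R)%type.

Lemma norm_triple (y : V) (c : R) :
  (`|y| <= c) = [&& `|y.1.1| <= c, `|y.1.2| <= c & `|y.2| <= c].
Proof. by rewrite prod_normE /= ge_max prod_normE /= ge_max andbA. Qed.

Lemma compact_ball_triple (rho : R) : compact [set y : V | `|y| <= rho].
Proof.
rewrite (_ : [set y : V | _] = ([set x : 'rV[R]_m | `|x| <= rho]
  `*` [set x : 'rV[R]_d | `|x| <= rho]) `*` `[- rho, rho]); last first.
  apply/seteqP; split=> y /=; rewrite norm_triple in_itv /= -ler_norml.
    by case/and3P.
  by case=> -[-> ->] ->.
apply: compact_setX; last exact: segment_compact.
by apply: compact_setX; exact: compact_ball_row.
Qed.

Definition dirx (k : 'I_d) : V := (0, delta_mx ord0 k, 0).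
Definition dirt : V := (0, 0, 1).
(** The canonical basis of the space of triples (parameter, position, time). *)
Definition std_dir (i : 'I_m + 'I_d + unit) : V :=
  match i with
  | inl (inl j) => (delta_mx ord0 j, 0, 0)
  | inl (inr k) => dirx k
  | inr _ => dirt
  end.

Definition std_coord (y : V) (i : 'I_m + 'I_d + unit) : R :=
  match i with
  | inl (inl j) => y.1.1 ord0 j
  | inl (inr k) => y.1.2 ord0 k
  | inr _ => y.2
  end.

Lemma big_sumType3 (F : 'I_m + 'I_d + unit -> V) :
  \sum_i F i = \sum_j F (inl (inl j)) + \sum_k F (inl (inr k)) + F (inr tt).
Proof.
rewrite big_sumType /= big_sumType /=; congr (_ + _).
by rewrite (bigD1 tt) //= big1 ?addr0 // => -[].
Qed.

Lemma fst_sum (W W' : zmodType) (I : finType) (F : I -> W * W') :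
  (\sum_i F i).1 = \sum_i (F i).1.
Proof. exact: (big_morph (@fst W W')). Qed.

Lemma snd_sum (W W' : zmodType) (I : finType) (F : I -> W * W') :
  (\sum_i F i).2 = \sum_i (F i).2.
Proof. exact: (big_morph (@snd W W')). Qed.

Lemma std_coordE (y : V) : y = \sum_i std_coord y i *: std_dir i.
Proof.
rewrite big_sumType3 /=; case: y => -[a b] c /=.
have E1 : \sum_j a ord0 j *: ((delta_mx ord0 j, 0, 0) : V) = (a, 0, 0).
  rewrite [LHS]surjective_pairing fst_sum snd_sum [X in (X, _)]surjective_pairing
    fst_sum snd_sum /=.
  rewrite (eq_bigr (fun j => a ord0 j *: delta_mx ord0 j)) // -row_sum_delta.
  by rewrite !big1 // => j _; rewrite /= scaler0.
have E2 : \sum_k b ord0 k *: dirx k = (0, b, 0).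
  rewrite [LHS]surjective_pairing fst_sum snd_sum [X in (X, _)]surjective_pairing
    fst_sum snd_sum /=.
  rewrite [X in (_, X, _)](eq_bigr (fun j => b ord0 j *: delta_mx ord0 j)) // -row_sum_delta.
  by rewrite !big1 // => j _; rewrite /= scaler0.
rewrite E1 E2 /dirt.
by congr (_, _, _) => /=; rewrite ?scaler0 ?addr0 ?add0r // /GRing.scale /= mulr1.
Qed.

Lemma std_basis : bounded_basis std_dir.
Proof.
move=> y; exists (std_coord y); first exact: std_coordE.
move=> i; have : `|y| <= `|y| by []. rewrite norm_triple => /and3P[h1 h2 h3].
case: i => [[j|k]|[]] //=; first exact: le_trans (coord_le_norm _ _) h1.
exact: le_trans (coord_le_norm _ _) h2.
Qed.

Lemma slice_derive_x (F : V -> R) th x t k :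
  'D_(delta_mx ord0 k) (fun y => F (th, y, t)) x = 'D_(dirx k) F (th, x, t).
Proof.
apply: derive_quotient => h; congr (F _ - _).
by congr (_, _, _); rewrite /= scaler0 add0r.
Qed.

Lemma slice_derive_t (F : V -> R) th x t :
  'D_1 (fun s => F (th, x, s)) t = 'D_dirt F (th, x, t).
Proof.
apply: derive_quotient => h; congr (F _ - _).
by congr (_, _, _); rewrite /= scaler0 add0r.
Qed.

Lemma slice_differentiable (G : V -> R) th x t : differentiable G (th, x, t) ->
  differentiable (fun y => G (th, y, t)) x.
Proof.
move=> dG; apply: (@differentiable_comp _ _ _ _ (fun y : 'rV[R]_d => (th, y, t)) G) => //.
apply: differentiable_pair; last exact: differentiable_cst.
by apply: differentiable_pair; first exact: differentiable_cst.
Qed.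

Variable F : V -> R.
Hypothesis F3 : Ck 3 F.

Lemma Ck2_derive v : Ck 2 (fun y => 'D_v F y).
Proof. by case: F3 => _; exact. Qed.

Lemma Ck1_derive2 v w : Ck 1 (fun y => 'D_w (fun z => 'D_v F z) y).
Proof. by have [_ /(_ w)] := Ck2_derive v. Qed.

Lemma Ck2_net : Ck 2 F.
Proof.
have [dF ddF] := F3; split => // v; have [d1 d2] := ddF v; split => // w.
by case: (d2 w) => d3 _ x; exact: differentiable_continuous.
Qed.

Definition netgrad (y : V) : 'rV[R]_d := \row_k 'D_(dirx k) F y.

Lemma netgrad_slice th t x : grad (fun y => F (th, y, t)) x = netgrad (th, x, t).
Proof. by apply/rowP => k; rewrite !mxE slice_derive_x. Qed.

Lemma netgrad_slice_differentiable th t x :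
  differentiable (fun y => netgrad (th, y, t)) x.
Proof.
have -> : (fun y => netgrad (th, y, t))
    = \sum_k (fun y => 'D_(dirx k) F (th, y, t) *: delta_mx ord0 k).
  apply/funext => y; rewrite fct_sumE /= [LHS]row_sum_delta.
  by apply: eq_bigr => k _; rewrite mxE.
apply: differentiable_sum => k; apply: differentiableZl.
by apply: (@slice_differentiable (fun y => 'D_(dirx k) F y)); case: (Ck2_derive (dirx k)).
Qed.

Variable H : 'rV[R]_d -> 'rV[R]_d -> R.
Hypothesis H_diff : forall z : 'rV[R]_d * 'rV[R]_d,
  differentiable (fun z : 'rV[R]_d * 'rV[R]_d => H z.1 z.2) z.

(** What the gradient of the residual is at interior times, with the mixed second
derivatives in the order in which they arise.  The formula makes sense for all times,
so that it can be studied on balls. *)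
Definition resgrad (y : V) : 'rV[R]_d := \row_k
  ('D_(dirx k) (fun z => 'D_dirt F z) y + (dHx H (y.1.2, netgrad y)) ord0 k
   + \sum_l (dHp H (y.1.2, netgrad y)) ord0 l
       * 'D_(dirx k) (fun z => 'D_(dirx l) F z) y).

(** Joint differentiability of [H] is what allows both arguments to move; the two
partial gradients are the components of its differential. *)
Lemma hamiltonian_chain (U : 'rV[R]_d -> 'rV[R]_d) x k : differentiable U x ->
  'D_(delta_mx ord0 k) (fun y => H y (U y)) x =
  (dHx H (x, U x)) ord0 k
  + \sum_l (dHp H (x, U x)) ord0 l * ('D_(delta_mx ord0 k) U x) ord0 l.
Proof.
move=> dU; pose Hh (z : 'rV[R]_d * 'rV[R]_d) := H z.1 z.2.
pose G y := (y, U y).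
have dG : differentiable G x by exact: differentiable_pair.
have dHh : differentiable Hh (G x) by exact: H_diff.
have -> : (fun y => H y (U y)) = Hh \o G by [].
set v := delta_mx ord0 k; set u := 'D_v U x.
have did : differentiable (fun y : 'rV[R]_d => y) x by exact: ex_diff.
have dGv : 'd G x v = (v, u).
  rewrite (diff_pair did dU); congr (_, _); last by rewrite /u deriveE.
  by rewrite -(deriveE _ did); exact: derive_id.
rewrite (deriveE _ (differentiable_comp dG dHh)) (diff_comp dG dHh) /= dGv /G.
have -> : (v, u) = (v, 0) + (0, u) by congr (_, _); rewrite /= ?addr0 ?add0r.
rewrite linearD /=; congr (_ + _).
  rewrite -deriveE // mxE; apply: derive_quotient => h; congr (_ - _).
  by rewrite /Hh /= scaler0 add0r.
have -> : (0, u) = \sum_l u ord0 l *: ((0, delta_mx ord0 l) : 'rV[R]_d * 'rV[R]_d).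
  rewrite [RHS]surjective_pairing fst_sum snd_sum /= -row_sum_delta.
  by congr (_, _); rewrite big1 // => j _; rewrite /= scaler0.
rewrite linear_sum; apply: eq_bigr => l _.
rewrite linearZ /= -deriveE // mulrC; congr (_ * _).
rewrite mxE; apply: derive_quotient => h; congr (_ - _).
by rewrite /Hh /= scaler0 add0r.
Qed.

(** At interior times the network coincides with its extension [F] near [t], so
that the time derivative can be computed on [F]. *)
Lemma grad_residual (u : 'rV[R]_d -> R -> R) (T : R) th t x : 0 < t < T ->
  (forall y s, 0 <= s <= T -> u y s = F (th, y, s)) ->
  grad (hj_residual H u t) x = resgrad (th, x, t).
Proof.
move=> /andP[t0 tT] uF.
pose A y := 'D_dirt F (th, y, t); pose B y := H y (netgrad (th, y, t)).
have E : hj_residual H u t = (fun y => A y + B y).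
  apply/funext => y.
  change (hj_residual H u t y = 'D_dirt F (th, y, t) + H y (netgrad (th, y, t))).
  rewrite /hj_residual; congr (_ + H _ _).
    rewrite -slice_derive_t; apply: near_eq_derive.
      near=> s; apply: uF; apply/andP; split; apply: ltW.
        by near: s; exact: lt_nbhsr.
      by near: s; exact: lt_nbhsl.
  rewrite -netgrad_slice; congr grad; apply/funext => z; apply: uF.
  by rewrite !ltW.
rewrite {}E.
have dA : differentiable A x.
  by apply: (@slice_differentiable (fun y => 'D_dirt F y)); case: (Ck2_derive dirt).
have dU := netgrad_slice_differentiable th t x.
have dB : differentiable B x.
  apply: (@differentiable_comp _ _ _ _ (fun y => (y, netgrad (th, y, t)))
    (fun z : 'rV[R]_d * 'rV[R]_d => H z.1 z.2)); last exact: H_diff.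
  exact: differentiable_pair.
apply/rowP => k; rewrite [LHS]mxE [RHS]mxE -addrA.
rewrite (derive_add _ dA dB).
have -> : 'D_(delta_mx ord0 k) A x = 'D_(dirx k) (fun z => 'D_dirt F z) (th, x, t).
  exact: (slice_derive_x (fun z => 'D_dirt F z) th x t k).
have -> : 'D_(delta_mx ord0 k) B x = dHx H (x, netgrad (th, x, t)) ord0 k
  + \sum_l dHp H (x, netgrad (th, x, t)) ord0 l
      * 'D_(delta_mx ord0 k) (fun y => netgrad (th, y, t)) x ord0 l.
  exact: hamiltonian_chain.
congr (_ + (_ + _)); apply: eq_bigr => l _; congr (_ * _).
rewrite derive_mx; last exact: diff_derivable.
rewrite mxE.
have -> : (fun y => netgrad (th, y, t) ord0 l) = (fun y => 'D_(dirx l) F (th, y, t)).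
  by apply/funext => y; rewrite mxE.
exact: (slice_derive_x (fun z => 'D_(dirx l) F z) th x t k).
Unshelve. all: by end_near. Qed.

End network.

Section residual_estimate.
Variables (R : realType) (m d : nat).
Notation V := ('rV[R]_m * 'rV[R]_d * R)%type.
Variable F : V -> R.
Hypothesis F3 : Ck 3 F.
Variable H : 'rV[R]_d -> 'rV[R]_d -> R.

Lemma Ck2_Ck1 (f : V -> R) : Ck 2 f -> Ck 1 f.
Proof.
by move=> [df ddf]; split => // v x; apply: differentiable_continuous; case: (ddf v).
Qed.

Variable L : R.
Hypothesis L0 : 0 <= L.
Hypothesis fieldL : forall z w, `|ham_field H z - ham_field H w| <= L * `|z - w|.

Lemma dHp_lip z w : `|dHp H z - dHp H w| <= L * `|z - w|.
Proof. exact: le_trans (norm_fst (ham_field H z - ham_field H w)) (fieldL z w). Qed.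

Lemma dHx_lip z w : `|dHx H z - dHx H w| <= L * `|z - w|.
Proof.
apply: le_trans (fieldL z w).
have := norm_snd (ham_field H z - ham_field H w); rewrite /= opprK.
by rewrite [- _ + _]addrC distrC.
Qed.

Lemma netgrad_ball_lipschitz : ball_lipschitz (netgrad F).
Proof.
apply: ball_lipschitz_row => k; apply: Ck1_ball_lipschitz.
- exact: compact_ball_triple.
- exact: std_basis.
- by apply: Ck2_Ck1; exact: Ck2_derive F3 _.
Qed.

Lemma resgrad_ball_lipschitz : ball_lipschitz (resgrad F H).
Proof.
have c1 v w : ball_lipschitz (fun y => 'D_w (fun z => 'D_v F z) y).
  by apply: (Ck1_ball_lipschitz (@compact_ball_triple R m d) (@std_basis R m d)); exact: Ck1_derive2 F3 _ _.
have arg : ball_lipschitz (fun y : V => (y.1.2, netgrad F y)).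
  apply: ball_lipschitz_pair; last exact: netgrad_ball_lipschitz.
  apply: (@ball_lipschitz_lip _ _ _ _ 1) => // x y; rewrite mul1r.
  exact: le_trans (norm_snd (x.1 - y.1)) (norm_fst (x - y)).
apply: ball_lipschitz_row => k.
apply: ball_lipschitzD.
  apply: ball_lipschitzD; first exact: c1.
  by apply: ball_lipschitz_coord; apply: ball_lipschitz_comp arg; exact: dHx_lip.
apply: ball_lipschitz_sum => l; apply: ball_lipschitzM; last exact: c1.
by apply: ball_lipschitz_coord; apply: ball_lipschitz_comp arg; exact: dHp_lip.
Qed.

(** The increment of the trajectory has no component along the parameter. *)
Lemma derive_increment (f : V -> R) (th : 'rV[R]_m) (x x' : 'rV[R]_d) (t h a : R) (b : 'I_d -> R) :
  differentiable f (th, x, t) ->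
  'D_(dirt R m d) f (th, x, t) = a -> (forall l, 'D_(dirx R m l) f (th, x, t) = b l) ->
  'D_((th, x', t + h) - (th, x, t)) f (th, x, t) = h * a + \sum_l (x' - x) ord0 l * b l.
Proof.
move=> df <- fb; rewrite (derive_basis df (std_coordE _)) big_sumType /= big_sumType /=.
rewrite (_ : \sum_(i < m) _ = 0) ?add0r; last by apply: big1 => j _; rewrite !mxE subrr mul0r.
rewrite addrC; congr (_ + _); last by apply: eq_bigr => l _; rewrite fb.
by rewrite (bigD1 tt) //= big1 ?addr0 => [|[]//]; rewrite addrC addKr.
Qed.

(** The discrepancy splits into four terms: [H_x] and [H_p] taken at the gradient of
the network instead of the numerical momentum, which gives the terms in [|e|]; the
Taylor remainder of the gradient of the network; and the consistency errors of the
integrator in position and in momentum. *)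
Lemma resgrad_coord_estimate (rho kappa : R) k : 0 <= kappa -> exists2 C : R, 0 <= C &
  forall (th : 'rV[R]_m) (x p x' p' : 'rV[R]_d) (t h : R), `|((th, x, t) : V)| <= rho -> `|((th, x', t + h) : V)| <= rho ->
    `|p| <= rho -> 0 < h <= 1 ->
    `|x' - x - h *: dHp H (x, p)| <= kappa * h ^+ 2 ->
    `|p' - p + h *: dHx H (x, p)| <= kappa * h ^+ 2 ->
    `|h * resgrad F H (th, x, t) ord0 k
      - ((netgrad F (th, x', t + h) - p') - (netgrad F (th, x, t) - p)) ord0 k|
     <= C * h * (h + `|netgrad F (th, x, t) - p|).
Proof.
move=> k0.
have [C1 C10 taylor] := Ck2_taylor (@compact_ball_triple R m d) (@std_basis R m d) (Ck2_derive F3 (dirx R m k)) rho.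
have /choice[B hB] : forall l, exists B : R, 0 <= B /\ forall y : V, `|y| <= rho ->
    `|'D_(dirx R m k) (fun z => 'D_(dirx R m l) F z) y| <= B.
  move=> l; have [B B0 h] := ball_lipschitz_bounded
    (Ck1_ball_lipschitz (@compact_ball_triple R m d) (@std_basis R m d) (Ck1_derive2 F3 (dirx R m l) (dirx R m k))) rho.
  by exists B.
have B0 l : 0 <= B l by case: (hB l).
pose S := \sum_l B l; have S0 : 0 <= S by exact: sumr_ge0.
pose A1 := `|ham_field H 0| + L * `|rho|.
have A10 : 0 <= A1 by rewrite addr_ge0 // mulr_ge0.
pose C2 := A1 + kappa + 1.
have C20 : 0 <= C2 by rewrite addr_ge0 // addr_ge0.
exists (L + (L + kappa) * S + C1 * C2 ^+ 2 + kappa).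
  by rewrite !addr_ge0 // mulr_ge0 // ?addr_ge0 // exprn_ge0.
move=> th x p x' p' t h yr y'r pr /andP[h0 h1] hx hp.
set y : V := (th, x, t); set y' : V := (th, x', t + h).
set U := netgrad F y; set e := U - p.
have xr : `|x| <= rho by move: yr; rewrite norm_triple => /and3P[].
have zz : `|(x, U) - (x, p)| <= `|e|.
  by apply: norm_pair; rewrite //= subrr normr0.
have hxx : `|x' - x| <= (A1 + kappa) * h.
  rewrite -(subrK (h *: dHp H (x, p)) (x' - x)).
  apply: le_trans (ler_normD _ _) _; rewrite addrC mulrDl; apply: lerD.
    rewrite normrZ gtr0_norm // mulrC; apply: ler_wpM2r; first exact: ltW.
    apply: le_trans (norm_fst (ham_field H (x, p))) _.
    rewrite -(subrK (ham_field H 0) (ham_field H (x, p))) addrC.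
    apply: le_trans (ler_normD _ _) _; rewrite lerD2l.
    apply: le_trans (fieldL _ _) _; rewrite subr0; apply: ler_wpM2l => //.
    by apply: le_trans (ler_norm rho); apply: norm_pair.
  apply: le_trans hx _; apply: ler_wpM2l => //.
  by rewrite expr2 ler_piMr // ltW.
have hyy : `|y' - y| <= C2 * h.
  rewrite norm_triple /=; apply/and3P; split.
  - by rewrite subrr normr0 mulr_ge0 // ltW.
  - by apply: le_trans hxx _; apply: ler_wpM2r; rewrite ?lerDl // ltW.
  - rewrite addrC addKr gtr0_norm //; apply: ler_peMl; first exact: ltW.
    by rewrite /C2 lerDr addr_ge0.
have r1 : `|U ord0 k - netgrad F y' ord0 k + (h * 'D_(dirx R m k) (fun z => 'D_(dirt R m d) F z) y
    + \sum_l (x' - x) ord0 l * 'D_(dirx R m k) (fun z => 'D_(dirx R m l) F z) y)| <= C1 * C2 ^+ 2 * h ^+ 2.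
  have dG : differentiable (fun z => 'D_(dirx R m k) F z) y by case: (Ck2_derive F3 (dirx R m k)).
  have inc := derive_increment x' h dG (derive_comm (dirt R m d) (dirx R m k) y (Ck2_net F3))
    (fun l => derive_comm (dirx R m l) (dirx R m k) y (Ck2_net F3)).
  have := taylor y y' yr y'r; rewrite [X in `|_ - X| <= _]inc {inc} => hh.
  apply: le_trans (_ : _ <= C1 * `|y' - y| ^+ 2) _.
    apply: (le_trans _ hh); rewrite -normrN le_eqVlt; apply/orP; left; apply/eqP.
    by rewrite !mxE; congr (`|_|); ring.
  rewrite -mulrA -exprMn; apply: ler_wpM2l => //.
  by rewrite lerXn2r ?nnegrE ?mulr_ge0 // ltW.
have EB1 (a b c : 'rV[R]_d) (s : R) l : (a - b - s *: c) ord0 l = (a - b) ord0 l - s * c ord0 l.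
  by rewrite !mxE.
have EB2 (a b : 'rV[R]_d) l : (a - b) ord0 l = a ord0 l - b ord0 l by rewrite !mxE.
have r2 : `|p' ord0 k - p ord0 k + h * dHx H (x, p) ord0 k| <= kappa * h ^+ 2.
  apply: (le_trans _ hp); have := coord_le_norm (p' - p + h *: dHx H (x, p)) k.
  by rewrite 4!mxE.
have r3 l : `|(x' - x) ord0 l - h * dHp H (x, p) ord0 l| <= kappa * h ^+ 2.
  apply: (le_trans _ hx); have := coord_le_norm (x' - x - h *: dHp H (x, p)) l.
  by rewrite EB1.
have r4 : `|dHx H (x, U) ord0 k - dHx H (x, p) ord0 k| <= L * `|e|.
  apply: (le_trans _ (ler_wpM2l L0 zz)); apply: (le_trans _ (dHx_lip _ _)).
  have := coord_le_norm (dHx H (x, U) - dHx H (x, p)) k.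
  by rewrite EB2.
have r5 l : `|dHp H (x, U) ord0 l - dHp H (x, p) ord0 l| <= L * `|e|.
  apply: (le_trans _ (ler_wpM2l L0 zz)); apply: (le_trans _ (dHp_lip _ _)).
  have := coord_le_norm (dHp H (x, U) - dHp H (x, p)) l.
  by rewrite EB2.
pose W l := 'D_(dirx R m k) (fun z => 'D_(dirx R m l) F z) y.
have r6 : `|\sum_l ((h * (dHp H (x, U) ord0 l - dHp H (x, p) ord0 l)
    - ((x' - x) ord0 l - h * dHp H (x, p) ord0 l)) * W l)|
     <= (h * (L * `|e|) + kappa * h ^+ 2) * S.
  apply: le_trans (ler_norm_sum _ _ _) _; rewrite /S mulr_sumr.
  apply: ler_sum => l _; rewrite normrM; apply: ler_pM => //; last by case: (hB l) => _; apply.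
  apply: le_trans (ler_normB _ _) _; apply: lerD; last exact: r3.
  by rewrite normrM gtr0_norm //; apply: ler_wpM2l; [exact: ltW|exact: r5].
have E : h * resgrad F H y ord0 k - ((netgrad F y' - p') - (U - p)) ord0 k =
  h * (dHx H (x, U) ord0 k - dHx H (x, p) ord0 k)
  + \sum_l ((h * (dHp H (x, U) ord0 l - dHp H (x, p) ord0 l)
    - ((x' - x) ord0 l - h * dHp H (x, p) ord0 l)) * W l)
  + (U ord0 k - netgrad F y' ord0 k + (h * 'D_(dirx R m k) (fun z => 'D_(dirt R m d) F z) y
    + \sum_l (x' - x) ord0 l * W l))
  + (p' ord0 k - p ord0 k + h * dHx H (x, p) ord0 k).
  have EB (a b c e0 : 'rV[R]_d) : (a - b - (c - e0)) ord0 k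
     = a ord0 k - b ord0 k - (c ord0 k - e0 ord0 k) by rewrite !mxE.
  rewrite EB.
  have -> : resgrad F H y ord0 k = 'D_(dirx R m k) (fun z => 'D_(dirt R m d) F z) y
    + dHx H (x, U) ord0 k + \sum_l dHp H (x, U) ord0 l * W l by rewrite mxE.
  have -> : \sum_l ((h * (dHp H (x, U) ord0 l - dHp H (x, p) ord0 l)
    - ((x' - x) ord0 l - h * dHp H (x, p) ord0 l)) * W l)
    = h * (\sum_l dHp H (x, U) ord0 l * W l) - \sum_l (x' - x) ord0 l * W l.
    by rewrite mulr_sumr -sumrB; apply: eq_bigr => l _; ring.
  by ring.
have r4' : `|h * (dHx H (x, U) ord0 k - dHx H (x, p) ord0 k)| <= h * (L * `|e|).
  by rewrite normrM gtr0_norm //; apply: ler_wpM2l; [exact: ltW|exact: r4].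
rewrite E; apply: le_trans (le_trans (ler_normD _ _) (lerD (le_trans (ler_normD _ _)
  (lerD (le_trans (ler_normD _ _) (lerD r4' r6)) r1)) r2)) _.
have e0 : 0 <= `|e| by [].
have q1 : 0 <= L * h * h by rewrite !mulr_ge0 // ltW.
have q2 : 0 <= kappa * h * `|e| * S by rewrite !mulr_ge0 // ltW.
have q3 : 0 <= L * h * h * S by rewrite !mulr_ge0 // ltW.
have q4 : 0 <= C1 * C2 ^+ 2 * h * `|e| by rewrite !mulr_ge0 ?exprn_ge0 // ltW.
have q5 : 0 <= kappa * h * `|e| by rewrite !mulr_ge0 // ltW.
rewrite -subr_ge0 [X in 0 <= X](_ : _ = L * h * h + kappa * h * `|e| * S + L * h * h * S
  + C1 * C2 ^+ 2 * h * `|e| + kappa * h * `|e|); last by ring.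
by rewrite !addr_ge0.
Qed.

Lemma residual_estimate (rho kappa : R) : 0 <= kappa -> exists2 C : R, 0 <= C &
  forall (th : 'rV[R]_m) (x p x' p' : 'rV[R]_d) (t h : R), `|((th, x, t) : V)| <= rho -> `|((th, x', t + h) : V)| <= rho ->
    `|p| <= rho -> 0 < h <= 1 ->
    `|x' - x - h *: dHp H (x, p)| <= kappa * h ^+ 2 ->
    `|p' - p + h *: dHx H (x, p)| <= kappa * h ^+ 2 ->
    enorm (resgrad F H (th, x, t)) <=
      enorm ((netgrad F (th, x', t + h) - p') - (netgrad F (th, x, t) - p)) / h
      + C * (h + enorm (netgrad F (th, x, t) - p)).
Proof.
move=> k0.
have /choice[C hC] : forall k : 'I_d, exists C : R, 0 <= C /\
  forall (th : 'rV[R]_m) (x p x' p' : 'rV[R]_d) (t h : R), `|((th, x, t) : V)| <= rho -> `|((th, x', t + h) : V)| <= rho ->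
    `|p| <= rho -> 0 < h <= 1 ->
    `|x' - x - h *: dHp H (x, p)| <= kappa * h ^+ 2 ->
    `|p' - p + h *: dHx H (x, p)| <= kappa * h ^+ 2 ->
    `|h * resgrad F H (th, x, t) ord0 k
      - ((netgrad F (th, x', t + h) - p') - (netgrad F (th, x, t) - p)) ord0 k|
     <= C * h * (h + `|netgrad F (th, x, t) - p|).
  by move=> k; have [C C0 h] := resgrad_coord_estimate rho k k0; exists C.
have C0 k : 0 <= C k by case: (hC k).
exists (\sum_k C k); first exact: sumr_ge0.
move=> th x p x' p' t h yr y'r pr h01 hx hp; have /andP[h0 _] := h01.
set y : V := (th, x, t); set D := (_ - p' - _); set e := netgrad F y - p.
pose r := resgrad F H y - h^-1 *: D.
have -> : resgrad F H y = h^-1 *: D + r by rewrite /r addrC subrK.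
apply: le_trans (enormD _ _) _; apply: lerD.
  by rewrite enormZ gtr0_norm ?invr_gt0 // mulrC.
apply: le_trans (enorm_le_sum _) _; rewrite mulr_suml; apply: ler_sum => k _.
apply: (@le_trans _ _ (C k * (h + `|e|))); last first.
  by apply: ler_wpM2l => //; rewrite lerD2l; exact: norm_le_enorm.
have := (hC k).2 th x p x' p' t h yr y'r pr h01 hx hp.
rewrite -/y -/D -/e => hk; rewrite -(ler_pM2l h0) -{1}(gtr0_norm h0) -normrM.
have -> : h * r ord0 k = h * resgrad F H y ord0 k - D ord0 k.
  have RE (a b : 'rV[R]_d) c : (a - c *: b) ord0 k = a ord0 k - c * b ord0 k by rewrite !mxE.
  by rewrite /r RE mulrBr mulrA divff ?gt_eqF // mul1r.
by apply: le_trans hk _; rewrite mulrCA mulrA.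
Qed.

End residual_estimate.

(** * Concentration for finitely valued samples *)

Section hoeffding.
Variable R : realType.

(** A second order bound on the exponential, enough for a sub-Gaussian tail with a
non-optimal constant; it follows from [expR x <= 1 / (1 - x)]. *)
Lemma expR_le_quad (x : R) : x <= 1 / 2 -> expR x <= 1 + x + 2 * x ^+ 2.
Proof.
move=> x2; have := expR_ge1Dx (- x); rewrite expRN => h.
have e0 := expR_gt0 x.
have h1 : (1 - x) * expR x <= 1 by rewrite -ler_pdivlMr // mul1r.
have q0 : 1 <= (1 + x + 2 * x ^+ 2) * (1 - x) by nra.
rewrite -(@ler_pM2r _ (1 - x)); first by rewrite mulrC; apply: le_trans q0.
by lra.
Qed.

(** Chernoff's method.  The sum over all outcomes of the product weights times the
exponential factorizes, and each factor is at most [expR (2 * s ^+ 2)] because the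
centred values have mean zero.  The choice [s = tau / 4] optimizes the exponent; it
satisfies [s <= 1 / 2] only when [tau <= 2], but for [tau > 1] the event is empty. *)
Lemma finite_hoeffding (V : finType) (N : nat) (q a : V -> R) (tau : R) :
  (0 < N)%N -> (forall v, 0 <= q v) -> \sum_v q v = 1 ->
  (forall v, 0 <= a v <= 1) -> 0 <= tau ->
  \sum_(f : {ffun 'I_N -> V} |
      N%:R^-1 * \sum_(k < N) a (f k) + tau < \sum_v q v * a v)
    \prod_(k < N) q (f k) <= expR (- (N%:R * tau ^+ 2 / 8)).
Proof.
move=> N0 q0 q1 a01 tau0; set mu := \sum_v q v * a v.
have N0' : 0 < N%:R :> R by rewrite ltr0n.
have mu0 : 0 <= mu by rewrite /mu; apply: sumr_ge0 => v _; rewrite mulr_ge0 //; case/andP: (a01 v).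
have mu1 : mu <= 1.
  rewrite -q1; apply: ler_sum => v _.
  by rewrite ler_piMr //; case/andP: (a01 v).
have [tau1|tau1] := leP tau 1; last first.
  rewrite big_pred0 ?expR_ge0 // => f; apply/negbTE; rewrite -leNgt.
  have : 0 <= N%:R^-1 * \sum_(k < N) a (f k).
    apply: mulr_ge0; first by rewrite invr_ge0 ltW.
    apply: sumr_ge0 => k _.
    by case/andP: (a01 (f k)).
  by move=> ?; lra.
(* With this [s] the exponent is [- s N tau + 2 s^2 N = - N tau^2 / 8]. *)
pose s := tau / 4.
pose X v := expR (s * (mu - a v)).
have H1 : \sum_v q v * X v <= expR (2 * s ^+ 2).
  apply: (@le_trans _ _ (\sum_v q v * (1 + s * (mu - a v) + 2 * s ^+ 2))).
    apply: ler_sum => v _; apply: ler_wpM2l => //.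
    have /andP[av0 av1] := a01 v.
    have sv : s * (mu - a v) <= 1/2 by rewrite /s; nra.
    apply: le_trans (expR_le_quad sv) _.
    rewrite lerD2l ler_wpM2l // exprMn ler_piMr ?sqr_ge0 //.
    by nra.
  rewrite (eq_bigr (fun v => q v * (1 + s * mu + 2 * s ^+ 2) - s * (q v * a v)));
    last by move=> v _; ring.
  rewrite big_split /= -mulr_suml q1 sumrN -mulr_sumr -/mu.
  by apply: le_trans (expR_ge1Dx _); lra.
apply: (@le_trans _ _ (\sum_(f : {ffun 'I_N -> V})
    expR (- (s * (N%:R * tau))) * \prod_(k < N) (q (f k) * X (f k)))).
  rewrite [leRHS](bigID (fun f : {ffun 'I_N -> V} => N%:R^-1 * \sum_(k < N) a (f k) + tau < mu)) /=.
  rewrite ler_wpDr //.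
    apply: sumr_ge0 => f _; rewrite mulr_ge0 ?expR_ge0 //.
    by apply: prodr_ge0 => k _; rewrite mulr_ge0 ?expR_ge0.
  apply: ler_sum => f hf; rewrite big_split /= mulrCA ler_peMr //.
    by apply: prodr_ge0.
  rewrite -expR_sum -expRD -[leLHS]expR0 ler_expR -mulr_sumr sumrB.
  rewrite sumr_const card_ord.
  have : \sum_(k < N) a (f k) + N%:R * tau < N%:R * mu.
    have := hf; rewrite -(ltr_pM2l N0') mulrDr mulrA divff ?gt_eqF // mul1r //.
  rewrite -mulr_natl => hf'.
  by rewrite addrC -mulrBr mulr_ge0 ?divr_ge0 //; lra.
rewrite -mulr_sumr -(bigA_distr_bigA (fun k v => q v * X v)) /=.
rewrite prodr_const card_ord.
apply: (@le_trans _ _ (expR (- (s * (N%:R * tau))) * expR (2 * s ^+ 2) ^+ N)).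
  rewrite ler_wpM2l ?expR_ge0 // lerXn2r ?nnegrE ?expR_ge0 //.
  by apply: sumr_ge0 => v _; rewrite mulr_ge0 ?expR_ge0.
rewrite -expRM_natl -expRD ler_expR /s.
by rewrite -subr_ge0 [leRHS](_ : _ = 0) //; field.
Qed.

End hoeffding.

Section measure.
Context (dT : measure_display) (T : measurableType dT) (R : realType).

Lemma measure_bigsetU_le (mu : {measure set T -> \bar R}) (I : Type) (s : seq I) (Q : pred I)
    (C : I -> set T) : (forall i, measurable (C i)) ->
  (mu (\big[setU/set0]_(i <- s | Q i) C i) <= \sum_(i <- s | Q i) mu (C i))%E.
Proof.
move=> mC; elim: s => [|i s IH]; first by rewrite !big_nil measure0.
rewrite !big_cons; case: ifP => _ //.
apply: le_trans (measureU2 _ _ _) _ => //; first exact: bigsetU_measurable.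
exact: leeD2l.
Qed.

Lemma in_bigsetU (I : finType) (Q : pred I) (C : I -> set T) w i :
  Q i -> C i w -> (\big[setU/set0]_(j | Q j) C j) w.
Proof. by move=> Qi Ciw; rewrite (bigD1 i) //=; left. Qed.

End measure.

Section sampling.
Context (dO : measure_display) (Om : measurableType dO) (R : realType).
Context (dT : measure_display) (T : measurableType dT).

(** Finitely many values make the bad event a finite union of product events, whose
probabilities the independence hypothesis gives directly. *)
Lemma sample_hoeffding (P : probability Om R) (N : nat) (X : 'I_N -> Om -> T)
    (V : finType) (b : T -> V) (q a : V -> R) (tau : R) :
  (0 < N)%N -> (forall k, measurable_fun setT (X k)) ->
  (forall v, measurable (b @^-1` [set v])) ->
  (forall k v, P (X k @^-1` (b @^-1` [set v])) = (q v)%:E) ->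
  (forall B : 'I_N -> set T, (forall k, measurable (B k)) ->
     P [set w | forall k, B k (X k w)] = (\prod_(k < N) P (X k @^-1` B k))%E) ->
  \sum_v q v = 1 -> (forall v, 0 <= a v <= 1) -> 0 <= tau ->
  exists2 D : set Om, measurable D /\ (P D <= (expR (- (N%:R * tau ^+ 2 / 8)))%:E)%E &
    forall w, ~ D w ->
      \sum_v q v * a v <= N%:R^-1 * \sum_(k < N) a (b (X k w)) + tau.
Proof.
move=> N0 mX mb Pq indep q1 a01 tau0.
pose Q (f : {ffun 'I_N -> V}) :=
  N%:R^-1 * \sum_(k < N) a (f k) + tau < \sum_v q v * a v.
pose C (f : {ffun 'I_N -> V}) := [set w | forall k, (b @^-1` [set f k]) (X k w)].
have mC f : measurable (C f).
  have -> : C f = \bigcap_(k in [set: 'I_N]) (X k @^-1` (b @^-1` [set f k])).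
    by apply/seteqP; split => w h; [move=> k _; exact: h|move=> k; exact: h].
  apply: fin_bigcap_measurable; first exact: finite_finset.
  by move=> k _; rewrite -[X in measurable X]setTI; exact: mX.
have q0 v : 0 <= q v.
  by rewrite -lee_fin -(Pq (Ordinal N0)) measure_ge0.
exists (\big[setU/set0]_(f | Q f) C f).
  split; first exact: bigsetU_measurable.
  apply: le_trans (measure_bigsetU_le _ _ _ mC) _.
  rewrite (eq_bigr (fun f : {ffun 'I_N -> V} => (\prod_(k < N) q (f k))%:E)); last first.
    move=> f _; apply: etrans (indep (fun k => b @^-1` [set f k]) (fun k => mb (f k))) _.
    by rewrite -prodEFin; apply: eq_bigr => k _; rewrite Pq.
  by rewrite sumEFin lee_fin; exact: finite_hoeffding.
move=> w nD; rewrite leNgt; apply/negP => lt; apply: nD.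
apply: (@in_bigsetU _ _ _ _ _ _ [ffun k => b (X k w)]).
  by rewrite /Q; under eq_bigr do rewrite ffunE.
by move=> k /=; rewrite ffunE.
Qed.

End sampling.

Section density.
Context (dT : measure_display) (T : measurableType dT) (R : realType).
Variable mu : {measure set T -> \bar R}.

Lemma integral_fiber_sum (V : finType) (b : T -> V) (f : T -> \bar R) :
  (forall v, measurable (b @^-1` [set v])) -> measurable_fun setT f ->
  (forall x, 0 <= f x)%E ->
  (\int[mu]_x f x = \sum_v \int[mu]_(x in b @^-1` [set v]) f x)%E.
Proof.
move=> mb mf f0.
have E : [set: T] = \big[setU/set0]_(v <- index_enum V) (b @^-1` [set v]).
  apply/seteqP; split => x // _.
  by rewrite (bigD1_seq (b x)) ?mem_index_enum ?index_enum_uniq //=; left.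
rewrite E ge0_integral_bigsetU //.
- exact: index_enum_uniq.
- by move=> u v _ _ [x [<- <-]].
- by rewrite -E.
Qed.

(** The set [G] carries the density, so a bound on [G] by a function of the bin is
enough, and the integral becomes a sum over bins. *)
Lemma integral_density_le (V : finType) (b : T -> V) (f rho : T -> R) (G : set T)
    (c q : V -> R) :
  (forall v, measurable (b @^-1` [set v])) -> measurable G ->
  measurable_fun setT f -> measurable_fun setT rho ->
  (forall x, 0 <= f x) -> (forall x, 0 <= rho x) ->
  (\int[mu]_(x in ~` G) (rho x)%:E = 0)%E ->
  (forall x, G x -> f x <= c (b x)) -> (forall v, 0 <= c v) ->
  (forall v, (\int[mu]_(x in b @^-1` [set v]) (rho x)%:E = (q v)%:E)%E) ->
  (\int[mu]_x (f x * rho x)%:E <= (\sum_v c v * q v)%:E)%E.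
Proof.
move=> mb mG mf mrho f0 rho0 G0 fc c0 bq.
have mc : measurable_fun setT (fun x => c (b x)).
  move=> _ Y mY; rewrite setTI.
  have -> : (fun x => c (b x)) @^-1` Y = \bigcup_(v in [set v | Y (c v)]) (b @^-1` [set v]).
    by apply/seteqP; split => x /=; [move=> Yx; exists (b x)|move=> [v /= Yv bx]; rewrite bx].
  by apply: fin_bigcup_measurable => //; exact: finite_finset.
have rho_ae : {ae mu, forall x, (~` G) x -> (rho x)%:E = 0%E}.
  have mE : measurable_fun (~` G) (EFin \o rho).
    by apply/measurable_EFinP; exact: measurable_funTS.
  have [+ _] := ae_eq_integral_abs mu (measurableC mG) mE; apply.
  rewrite -[RHS]G0; apply: eq_integral => x _ /=.
  by rewrite ger0_norm.
apply: (@le_trans _ _ (\int[mu]_x (c (b x) * rho x)%:E)%E).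
  apply: ae_ge0_le_integral => //.
  - by move=> x _; rewrite lee_fin mulr_ge0.
  - by apply/measurable_EFinP; exact: measurable_funM.
  - by move=> x _; rewrite lee_fin mulr_ge0.
  - by apply/measurable_EFinP; exact: measurable_funM.
  apply: filterS rho_ae => x rx _; have [Gx|nGx] := pselect (G x).
    by rewrite lee_fin ler_wpM2r // fc.
  by have [->] := rx nGx; rewrite !mulr0.
rewrite (@integral_fiber_sum _ b) //; last first.
- by move=> x; rewrite lee_fin mulr_ge0.
- by apply/measurable_EFinP; exact: measurable_funM.
rewrite -sumEFin; apply: lee_sum => v _.
rewrite EFinM -bq -ge0_integralZl //.
- apply: ge0_le_integral => //.
  + by move=> x _; rewrite lee_fin mulr_ge0.
  + by apply/measurable_EFinP; apply: measurable_funM; exact: measurable_funTS.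
  + by apply: measurable_funeM; apply/measurable_EFinP; exact: measurable_funTS.
  + by move=> x /= <-; rewrite -EFinM.
- by apply/measurable_EFinP; exact: measurable_funTS.
- by move=> x _; rewrite lee_fin.
- by rewrite lee_fin.
Qed.

End density.

Section bins.
Variables (R : realType) (M : nat).
Hypothesis M0 : (0 < M)%N.

(** Rounding [[0, 1]] down to multiples of [1 / M].  The last bin also receives the
values above 1, so that bins cover the line. *)
Definition bin (t : R) : 'I_M.+1 := inord (minn M (Num.truncn (M%:R * t))).
Definition bin_value (v : 'I_M.+1) : R := v%:R / M%:R.

Let M0' : 0 < M%:R :> R. Proof. by rewrite ltr0n. Qed.

Lemma val_bin t : bin t = minn M (Num.truncn (M%:R * t)) :> nat.
Proof. by rewrite inordK // ltnS geq_minl. Qed.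

Lemma bin_value_itv v : 0 <= bin_value v <= 1.
Proof.
rewrite /bin_value divr_ge0 ?ler0n //= ler_pdivrMr // mul1r ler_nat.
by rewrite -ltnS.
Qed.

Lemma bin_value_le t : 0 <= t -> bin_value (bin t) <= t.
Proof.
move=> t0; rewrite /bin_value val_bin ler_pdivrMr // [t * _]mulrC.
have Mt : 0 <= M%:R * t by rewrite mulr_ge0.
apply: (@le_trans _ _ (Num.truncn (M%:R * t))%:R); first by rewrite ler_nat geq_minr.
by rewrite truncn_le.
Qed.

Lemma le_bin_value t : 0 <= t <= 1 -> t <= bin_value (bin t) + M%:R^-1.
Proof.
move=> /andP[t0 t1]; rewrite /bin_value val_bin.
have Mt : 0 <= M%:R * t by rewrite mulr_ge0.
have h : (Num.truncn (M%:R * t))%:R <= M%:R * t by rewrite truncn_le.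
rewrite (minn_idPr _); last first.
  rewrite -(ler_nat R); apply: le_trans h _.
  by rewrite ler_piMr // ltW.
rewrite -[X in _ + X]mul1r -mulrDl natr1 ler_pdivlMr // mulrC.
by apply: ltW; exact: truncnS_gt.
Qed.

(** Rounding is nondecreasing, so bins are intervals. *)
Lemma measurable_bin (dT : measure_display) (T : measurableType dT) (f : T -> R) v :
  measurable_fun setT f ->
  measurable ((fun x => bin (f x)) @^-1` [set v]).
Proof.
move=> mf.
have -> : (fun x => bin (f x)) @^-1` [set v] = setT `&` f @^-1` (bin @^-1` [set v]).
  by rewrite setTI.
apply: mf => //; apply: is_interval_measurable => x y /= bx by_ t /andP[xt ty].
have bin_mono r s : r <= s -> (bin r <= bin s)%N.
  move=> rs; rewrite !val_bin leq_min geq_minl /=; apply: leq_trans (geq_minr _ _) _.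
  by apply: le_truncn; rewrite ler_wpM2l // ltW.
apply/val_inj/eqP; rewrite eqn_leq -{1}by_ bin_mono //= -bx.
exact: bin_mono.
Qed.

End bins.

Section integral_sample.
Context (dT : measure_display) (T : measurableType dT) (R : realType).
Variable mu : {measure set T -> \bar R}.

(** The concentration inequality is known for the binned values of [f0], a function
within [e] of [f].  Passing from [f] to [f0] on both sides costs [2 * e], and rounding
costs one bin of width [B / M]. *)
Lemma integral_sample_le (M N : nat) (f f0 rho : T -> R) (G : set T) (B e tau : R)
    (y : 'I_N -> T) (q : 'I_M.+1 -> R) :
  (0 < M)%N -> (0 < N)%N -> 0 < B -> 0 <= e -> measurable G ->
  measurable_fun setT f -> measurable_fun setT f0 -> measurable_fun setT rho ->
  (forall x, 0 <= f x) -> (forall x, 0 <= f0 x) -> (forall x, 0 <= rho x) ->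
  (\int[mu]_(x in ~` G) (rho x)%:E = 0)%E ->
  (forall x, G x -> f0 x <= B) -> (forall x, G x -> `|f x - f0 x| <= e) ->
  (forall k, G (y k)) ->
  (forall v, (\int[mu]_(x in (fun x => bin M (f0 x / B)) @^-1` [set v]) (rho x)%:E
      = (q v)%:E)%E) ->
  \sum_v q v = 1 ->
  \sum_v q v * bin_value R v
    <= N%:R^-1 * \sum_(k < N) bin_value R (bin M (f0 (y k) / B)) + tau ->
  (\int[mu]_x (f x * rho x)%:E
    <= (N%:R^-1 * \sum_(k < N) f (y k) + B * tau + B / M%:R + 2 * e)%:E)%E.
Proof.
move=> M0 N0 B0 e0 mG mf mf0 mrho fge0 f0ge0 rho0 G0 f0B ff0 yG qE q1 dev.
have M0' : 0 < M%:R :> R by rewrite ltr0n.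
have N0' : 0 < N%:R :> R by rewrite ltr0n.
pose c (v : 'I_M.+1) := B * (bin_value R v + M%:R^-1) + e.
apply: (@le_trans _ _ ((\sum_v c v * q v)%:E)).
  apply: (@integral_density_le _ _ _ mu _ (fun x => bin M (f0 x / B)) f rho G c q) => //.
  - move=> v; apply: (@measurable_bin R M _ T (fun x => f0 x / B)).
    apply: measurable_funM => //; exact: measurable_cst.
  - move=> x Gx; apply: (@le_trans _ _ (f0 x + e)).
      by rewrite -lerBlDl; apply: le_trans (ler_norm _) (ff0 x Gx).
    rewrite lerD2r mulrC -ler_pdivrMr //; apply: le_bin_value => //.
    apply/andP; split; first by rewrite divr_ge0 // ltW.
    by rewrite ler_pdivrMr // mul1r f0B.
  - move=> v; rewrite addr_ge0 // mulr_ge0 ?ltW // ltr_wpDl ?invr_gt0 //.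
    by case/andP: (@bin_value_itv R M M0 v).
rewrite lee_fin /c.
have -> : \sum_v (B * (bin_value R v + M%:R^-1) + e) * q v
    = B * (\sum_v q v * bin_value R v) + (B / M%:R + e) * \sum_v q v.
  by rewrite !mulr_sumr -big_split /=; apply: eq_bigr => v _; ring.
rewrite q1 mulr1; apply: le_trans (lerD (ler_wpM2l (ltW B0) dev) (lexx _)) _.
rewrite mulrDr mulrCA mulr_sumr.
suff h : N%:R^-1 * (\sum_(k < N) B * bin_value R (bin M (f0 (y k) / B)))
    <= N%:R^-1 * \sum_(k < N) f (y k) + e by lra.
rewrite -(@ler_pM2l _ N%:R) // mulrDr !mulrA divff ?gt_eqF // !mul1r.
have -> : N%:R * e = \sum_(k < N) e by rewrite sumr_const card_ord mulr_natl.
rewrite -big_split /=.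
apply: ler_sum => k _; apply: (@le_trans _ _ (f0 (y k))).
  rewrite mulrC -ler_pdivlMr //; apply: bin_value_le => //.
  by rewrite divr_ge0 // ltW.
rewrite -lerBlDl; apply: le_trans (ler_norm _) _.
by rewrite distrC ff0.
Qed.

End integral_sample.

Section union_bound.
Context (dO : measure_display) (Om : measurableType dO) (R : realType).

(** Level [j] may fail with probability [eps / 2^(j+1)], shared equally between the
events of that level. *)
Lemma countable_union_bound (P : probability Om R) (eps : R) (I : nat -> finType)
    (D : forall j, I j -> set Om) (Z : set Om) :
  0 <= eps -> measurable Z -> P Z = 0%E ->
  (forall j i, measurable (D j i)) ->
  (forall j i, (P (D j i) <= (eps / (2 ^ j.+1)%:R / #|I j|%:R)%:E)%E) ->
  exists A : set Om, [/\ measurable A, ((1 - eps)%:E <= P A)%E &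
    forall w, A w -> ~ Z w /\ forall j i, ~ D j i w].
Proof.
move=> eps0 mZ PZ mD PD.
pose U j := \big[setU/set0]_(i : I j) D j i.
have mU j : measurable (U j) by apply: bigsetU_measurable => i _; exact: mD.
have PU j : (P (U j) <= (eps / (2 ^ j.+1)%:R)%:E)%E.
  apply: le_trans (measure_bigsetU_le _ _ _ (mD j)) _.
  have e0 : 0 <= eps / (2 ^ j.+1)%:R by rewrite divr_ge0.
  apply: (@le_trans _ _ (\sum_(i : I j) (eps / (2 ^ j.+1)%:R / #|I j|%:R)%:E)%E).
    by apply: lee_sum => i _; exact: PD.
  rewrite sumEFin lee_fin sumr_const (_ : #|xpredT| = #|I j|); last exact: eq_card.
  rewrite -[leLHS]mulr_natr.
  have [->|c0] := eqVneq #|I j| 0%N; first by rewrite mulr0.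
  by rewrite divfK // pnatr_eq0.
pose W := \bigcup_j U j; have mW : measurable W by exact: bigcup_measurable.
have PW : (P W <= eps%:E)%E.
  have S : (P W <= \sum_(j <oo) P (U j))%E by exact: measure_sigma_subadditive.
  apply: le_trans S _.
  apply: le_trans (epsilon_trick0 xpredT eps0).
  by apply: lee_nneseries => j _ //; exact: PU.
have mZW : measurable (Z `|` W) by exact: measurableU.
exists (~` (Z `|` W)); split.
- exact: measurableC.
- rewrite probability_setC // EFinB; apply: leeB => //.
  apply: le_trans (measureU2 _ mZ mW) _.
  by move: PW; rewrite -[X in (X + _)%E]/(P Z) PZ add0e.
- move=> w nZW; split; first by move=> Zw; apply: nZW; left.
  move=> j i Dw; apply: nZW; right; exists j => //.
  exact: (@in_bigsetU _ _ _ xpredT _ _ i).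
Qed.

End union_bound.

(** * Uniformity in the parameter *)

Section grid.
Variables (R : realType) (m : nat).

Definition grid_point (j M : nat) (c : {ffun 'I_m -> 'I_(2 * j * M).+1}) : 'rV[R]_m :=
  \row_l ((c l)%:R / M%:R - j%:R).

Lemma norm_grid_point j M (c : {ffun 'I_m -> 'I_(2 * j * M).+1}) : (0 < M)%N ->
  `|grid_point c| <= j%:R.
Proof.
move=> M0; apply: norm_le_coord => // l; rewrite mxE ler_norml.
have M0' : 0 < M%:R :> R by rewrite ltr0n.
apply/andP; split; first by rewrite lerDr divr_ge0.
rewrite lerBlDr ler_pdivrMr // -natrD -natrM ler_nat.
by rewrite addnn -mul2n -ltnS.
Qed.

Lemma grid_dense j M (th : 'rV[R]_m) : (0 < M)%N -> `|th| <= j%:R ->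
  exists c : {ffun 'I_m -> 'I_(2 * j * M).+1}, `|grid_point c - th| <= M%:R^-1.
Proof.
move=> M0 thj; have M0' : 0 < M%:R :> R by rewrite ltr0n.
pose n l := Num.truncn ((th ord0 l + j%:R) * M%:R).
have tl l : - j%:R <= th ord0 l <= j%:R.
  by rewrite -ler_norml; exact: le_trans (coord_le_norm _ _) thj.
have t0 l : 0 <= (th ord0 l + j%:R) * M%:R.
  by rewrite mulr_ge0 // -lerBlDr sub0r; case/andP: (tl l).
have nl l : (n l < (2 * j * M).+1)%N.
  rewrite ltnS -(ler_nat R); apply: (@le_trans _ _ ((th ord0 l + j%:R) * M%:R)).
    by rewrite truncn_le.
  rewrite !natrM ler_pM2r // mulr_natl mulr2n lerD2r.
  by case/andP: (tl l).
exists [ffun l => Ordinal (nl l)]; apply: norm_le_coord; first by rewrite invr_ge0.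
move=> l; rewrite !mxE ffunE /=.
have h1 : (n l)%:R <= (th ord0 l + j%:R) * M%:R by rewrite truncn_le.
have h2 : (th ord0 l + j%:R) * M%:R < (n l).+1%:R by exact: truncnS_gt.
have h3 : (n l)%:R / M%:R <= th ord0 l + j%:R by rewrite ler_pdivrMr.
have h4 : th ord0 l + j%:R <= (n l)%:R / M%:R + M%:R^-1.
  have -> : (n l)%:R / M%:R + M%:R^-1 = (n l).+1%:R / M%:R :> R.
    by rewrite -natr1 mulrDl mul1r.
  by rewrite ler_pdivlMr //; exact: ltW.
have h5 : 0 <= M%:R^-1 :> R by rewrite invr_ge0.
by rewrite ler_norml; apply/andP; split; lra.
Qed.

End grid.

Section confidence.
Variable R : realType.

Definition log_rate (m j : nat) : R :=
  1 + m%:R + (j%:R * ln 2 + m%:R * ln (2 * j%:R + 1)) / ln 2.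

Lemma log_rate_ge0 m j : 0 <= log_rate m j.
Proof.
rewrite /log_rate addr_ge0 ?addr_ge0 // divr_ge0 ?addr_ge0 ?mulr_ge0 ?ln_ge0 ?ler1n //.
by rewrite lerDr mulr_ge0.
Qed.

(** [ln (2 / eps) >= ln 2] absorbs the terms of the logarithm that depend neither
on [M] nor on [eps], and [ln M] absorbs the powers of [M] coming from the grid. *)
Lemma log_confidence (m j M : nat) (eps : R) : (0 < M)%N -> 0 < eps < 1 ->
  - ln (eps / (2 ^ j.+1)%:R / (M * (2 * j * M).+1 ^ m)%:R)
    <= log_rate m j * (ln M%:R + ln (2 / eps)).
Proof.
move=> M0 /andP[eps0 eps1].
have M0' : 0 < M%:R :> R by rewrite ltr0n.
have M1 : 1 <= M%:R :> R by rewrite ler1n.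
have ln2 : 0 < ln 2 :> R by rewrite ln_gt0 // ltr1n.
have lM : 0 <= ln M%:R :> R by exact: ln_ge0.
have le2 : ln 2 <= ln (2 / eps) :> R.
  rewrite ler_ln ?posrE ?divr_gt0 // ler_pdivlMr //.
  by apply: ler_piMr => //; exact: ltW.
have p1 : 0 < (2 ^ j.+1)%:R :> R by rewrite ltr0n expn_gt0.
have p2 : 0 < (M * (2 * j * M).+1 ^ m)%:R :> R by rewrite ltr0n muln_gt0 M0 expn_gt0.
have j1 : 1 <= 2 * j%:R + 1 :> R by rewrite lerDr mulr_ge0.
have j0 : 0 < 2 * j%:R + 1 :> R by exact: lt_le_trans j1.
rewrite lnM ?posrE ?divr_gt0 ?invr_gt0 // lnM ?posrE ?invr_gt0 // !lnV ?posrE //.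
rewrite natrM lnM ?posrE ?ltr0n ?expn_gt0 // !natrX !lnXn ?ltr0n //.
have -> : ln (2 / eps) = ln 2 - ln eps :> R.
  by rewrite lnM ?posrE ?invr_gt0 // lnV ?posrE.
have le3 : ln ((2 * j * M).+1%:R) <= ln (2 * j%:R + 1) + ln M%:R :> R.
  rewrite -lnM ?posrE // ler_ln ?posrE ?ltr0n ?mulr_gt0 //.
  have -> : (2 * j * M).+1%:R = 2 * j%:R * M%:R + 1 :> R by rewrite -natr1 !natrM.
  by rewrite [leRHS]mulrDl [1 * _]mul1r lerD2l.
rewrite lnM ?posrE ?invr_gt0 // lnV ?posrE // in le2.
pose K : R := j%:R * ln 2 + m%:R * ln (2 * j%:R + 1).
have K0 : 0 <= K by apply: addr_ge0; apply: mulr_ge0 => //; [exact: ltW|exact: ln_ge0].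
have le4 : K <= K / ln 2 * (ln M%:R + (ln 2 - ln eps)).
  rewrite -mulrA ler_peMr // mulrC ler_pdivlMr // mul1r.
  by apply: le_trans le2 _; rewrite lerDr.
have le5 : m%:R * ln (2 * j * M).+1%:R <= m%:R * (ln (2 * j%:R + 1) + ln M%:R) :> R.
  by rewrite ler_wpM2l.
have le6 : 0 <= m%:R * (ln 2 - ln eps) :> R by rewrite mulr_ge0 //; apply: le_trans le2; exact: ltW.
rewrite /log_rate -/K -[ln 2 *+ _]mulr_natl -[ln _ *+ m]mulr_natl -[j.+1%:R]natr1 [leRHS]mulrDl.
move: le4; set Z := K / ln 2 * _ => le4; rewrite /K in le4.
lra.
Qed.

Lemma deviation_bound (m j M N : nat) (eps delta tau : R) : (0 < M)%N -> (0 < N)%N -> 0 < eps < 1 ->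
  delta = eps / (2 ^ j.+1)%:R / (M * (2 * j * M).+1 ^ m)%:R ->
  tau = Num.sqrt (8 * - ln delta / N%:R) ->
  expR (- (N%:R * tau ^+ 2 / 8)) = delta /\
  tau <= 4 * Num.sqrt (log_rate m j) *
     Num.sqrt ((ln M%:R + ln (2 / eps)) / (2 * N%:R)).
Proof.
move=> M0 N0 eps01 dE tE; have /andP[eps0 eps1] := eps01.
have N0' : 0 < N%:R :> R by rewrite ltr0n.
have p1 : 1 <= (2 ^ j.+1)%:R :> R by rewrite ler1n expn_gt0.
have p2 : 1 <= (M * (2 * j * M).+1 ^ m)%:R :> R by rewrite ler1n muln_gt0 M0 expn_gt0.
have d0 : 0 < delta by rewrite dE !divr_gt0 // (lt_le_trans ltr01).
have d1 : delta <= 1.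
  rewrite dE ler_pdivrMr ?(lt_le_trans ltr01) // mul1r.
  rewrite ler_pdivrMr ?(lt_le_trans ltr01) //.
  apply: le_trans (ltW eps1) _; rewrite -[leLHS]mulr1; exact: ler_pM.
have lnd : 0 <= - ln delta by rewrite oppr_ge0 ln_le0.
split.
  rewrite tE sqr_sqrtr; last by rewrite divr_ge0 // mulr_ge0.
  have -> : - (N%:R * (8 * - ln delta / N%:R) / 8) = ln delta by field; rewrite gt_eqF.
  by rewrite lnK.
have -> : 4 = Num.sqrt (16 : R).
  by rewrite (_ : 16 = 4 ^+ 2) ?sqrtr_sqr ?ger0_norm // -natrX.
rewrite tE -!sqrtrM ?mulr_ge0 ?log_rate_ge0 //.
rewrite ler_sqrt.
  have h := log_confidence m j M0 eps01; rewrite -dE in h.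
  rewrite ler_pdivrMr //.
  set Lg := ln _ + _ in h *; set Q := log_rate m j in h *.
  have -> : 16 * Q * (Lg / (2 * N%:R)) * N%:R = 8 * (Q * Lg) by field; rewrite gt_eqF.
  by rewrite ler_pM2l.
apply: mulr_ge0; first by rewrite mulr_ge0 // log_rate_ge0.
rewrite divr_ge0 ?mulr_ge0 // addr_ge0 ?ln_ge0 ?ler1n //.
by rewrite ler_pdivlMr // mul1r; apply: le_trans (ltW eps1) _; rewrite ler1n.
Qed.

End confidence.

(** * The Hamilton-Jacobi residual under the numerical density *)

Section borel_functions.
Variable R : realType.

Lemma borel_open n (U : set 'rV[R]_n) : open U -> measurable (U : set (borel R n)).
Proof. by move=> oU; exact: sub_sigma_algebra. Qed.

Lemma borel_closed n (U : set 'rV[R]_n) : closed U -> measurable (U : set (borel R n)).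
Proof.
move=> cU; rewrite -[X in measurable X]setCK; apply: measurableC.
by apply: borel_open; exact: closed_openC.
Qed.

Lemma borel_continuous_map n p (f : 'rV[R]_n -> 'rV[R]_p) : continuous f ->
  measurable_fun [set: borel R n] (f : borel R n -> borel R p).
Proof.
move=> fc; apply: (@measurability _ _ (borel R n) (borel R p) setT _ (@open 'rV[R]_p)) => //.
move=> _ [U oU <-]; rewrite setTI; apply: borel_open.
by apply: open_comp => // x _; exact: fc.
Qed.

Lemma borel_continuous n (f : 'rV[R]_n -> R) : continuous f ->
  measurable_fun [set: borel R n] (f : borel R n -> R).
Proof.
move=> fc; apply: (measurability _ (RGenOInfty.measurableE R)) => //.
move=> _ [_ [x ->] <-]; rewrite setTI; apply: borel_open.
by apply: open_comp; [move=> y _; exact: fc|exact: interval_open].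
Qed.

Lemma Ck1_grad_continuous n (g : 'rV[R]_n -> R) : Ck 1 g -> continuous (grad g).
Proof. by move=> [_ gc]; apply: row_continuous => j; exact: gc. Qed.

End borel_functions.

Section hamilton_jacobi.
Variables (R : realType) (d m r : nat) (T L1 L2 : R).
Variables (H : 'rV[R]_d -> 'rV[R]_d -> R) (g : 'rV[R]_d -> R) (rho0 : 'rV[R]_d -> R).
Variable Phi : R -> 'rV[R]_d * 'rV[R]_d -> 'rV[R]_d * 'rV[R]_d.
Hypothesis T0 : 0 < T.
Hypotheses (L10 : 0 <= L1) (L20 : 0 <= L2).
Hypotheses (HL1 : lipschitz_with L1 (dHp H)) (HL2 : lipschitz_with L2 (dHx H)).
Hypothesis g1 : Ck 1 g.
Hypothesis rho0P : prob_density rho0.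
Hypothesis rho0_cpt : compact (closure [set x : 'rV[R]_d | rho0 x != 0]).
Hypothesis r2 : (2 <= r)%N.
Hypothesis PhiH : integrator_of_order H Phi r.

Let L := (L1 + L2) * (d + d)%:R.
Let supp := closure [set x : 'rV[R]_d | rho0 x != 0].

Lemma field_lipschitz z w : `|ham_field H z - ham_field H w| <= L * `|z - w|.
Proof.
have c0 : 0 <= (d + d)%:R * `|z - w| by rewrite mulr_ge0.
apply: norm_pair => /=.
  apply: le_trans (lipschitz_norm L10 HL1 z w) _.
  by rewrite /L -!mulrA mulrDl lerDl mulr_ge0.
rewrite -opprD normrN; apply: le_trans (lipschitz_norm L20 HL2 z w) _.
by rewrite /L -!mulrA mulrDl lerDr mulr_ge0.
Qed.

Let L0 : 0 <= L. Proof. by rewrite mulr_ge0 // addr_ge0. Qed.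

Lemma initial_data_continuous : continuous (fun x : 'rV[R]_d => (x, grad g x)).
Proof.
apply: pair_continuous; last exact: Ck1_grad_continuous.
by move=> x; exact: cvg_id.
Qed.

Lemma numsol_continuous (h : R) i : 0 < h <= 1 -> continuous (numsol Phi g h i).
Proof.
move=> h01 x; apply: (@continuous_comp _ _ _ (fun x => (x, grad g x)) (iter i (Phi h))).
  exact: initial_data_continuous.
exact: (iter_continuous PhiH).
Qed.

Lemma numsol_bounded : exists2 rho : R, 0 <= rho &
  forall (M i : nat) x, T <= M%:R -> (i <= M)%N -> supp x ->
    `|numsol Phi g (T / M%:R) i x| <= rho.
Proof.
have Kcpt : compact ((fun x => (x, grad g x)) @` supp).
  apply: continuous_compact => //; apply: continuous_subspaceT.
  exact: initial_data_continuous.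
have [rho rho00 h] := integrator_bounded L0 field_lipschitz r2 PhiH T0 Kcpt.
exists rho => // M i x TM iM sx; apply: h => //.
by exists x.
Qed.

Lemma rho0_support x : ~ supp x -> rho0 x = 0.
Proof.
move=> sx; apply/eqP/negPn/negP => r0; apply: sx; exact: subset_closure.
Qed.

Variable F : 'rV[R]_m * 'rV[R]_d * R -> R.
Hypothesis F3 : Ck 3 F.

(** Numerical trajectories stay in the ball of radius [rho], so all the triples
(parameter, position, time) that occur lie in one ball, of radius [j + rho + T].  The
three constants are the bound used for the bins, the cost of moving to the grid, and
the constant of [residual_estimate]. *)
Lemma level_constants (rho kappa : R) (j : nat) : 0 <= rho -> 0 <= kappa ->
  exists k : R * R * R, [/\ 0 < k.1.1, 0 <= k.1.2, 0 <= k.2,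
  (forall (th : 'rV[R]_m) (x : 'rV[R]_d) (t : R), `|th| <= j%:R -> `|x| <= rho -> 0 <= t <= T ->
     enorm (resgrad F H (th, x, t)) <= k.1.1) /\
  (forall (th th' : 'rV[R]_m) (x : 'rV[R]_d) (t : R), `|th| <= j%:R -> `|th'| <= j%:R ->
     `|x| <= rho -> 0 <= t <= T ->
     `|enorm (resgrad F H (th, x, t)) - enorm (resgrad F H (th', x, t))|
        <= k.1.2 * `|th - th'|) &
  (forall (th : 'rV[R]_m) (x p x' p' : 'rV[R]_d) (t h : R), `|th| <= j%:R ->
     `|x| <= rho -> `|x'| <= rho -> `|p| <= rho -> 0 < h <= 1 -> 0 <= t -> t + h <= T ->
    `|x' - x - h *: dHp H (x, p)| <= kappa * h ^+ 2 ->
    `|p' - p + h *: dHx H (x, p)| <= kappa * h ^+ 2 ->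
    enorm (resgrad F H (th, x, t)) <=
      enorm ((netgrad F (th, x', t + h) - p') - (netgrad F (th, x, t) - p)) / h
      + k.2 * (h + enorm (netgrad F (th, x, t) - p)))].
Proof.
move=> rho00 kappa0; pose rad : R := j%:R + rho + T.
have j0 : 0 <= j%:R :> R by [].
have inball (th : 'rV[R]_m) (x : 'rV[R]_d) (t : R) : `|th| <= j%:R -> `|x| <= rho -> 0 <= t <= T ->
    `|(th, x, t)| <= rad.
  move=> hth hx /andP[t0 tT]; rewrite norm_triple /= (ger0_norm t0) /rad.
  by apply/and3P; split; have := T0; lra.
have lip := resgrad_ball_lipschitz F3 field_lipschitz.
have [B B0 hB] := ball_lipschitz_bounded lip rad.
have [K K0 hK] := lip rad.
have [C C0 hC] := residual_estimate F3 L0 field_lipschitz rad kappa0.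
exists (d%:R * B + 1, d%:R * K, C); split => //=.
- by rewrite ltr_wpDl // mulr_ge0.
- by rewrite mulr_ge0.
- split.
    move=> th x t hth hx ht; apply: le_trans (enorm_le_norm _) _.
    apply: ler_wpDr => //; apply: ler_wpM2l => //; apply: hB; exact: inball.
  move=> th th' x t hth hth' hx ht.
  set a := resgrad F H (th, x, t); set b := resgrad F H (th', x, t).
  have ab := enorm_dist a b.
  apply: le_trans ab _; apply: le_trans (enorm_le_norm _) _; rewrite -mulrA.
  apply: ler_wpM2l => //.
  apply: le_trans (hK _ _ (inball _ _ _ hth hx ht) (inball _ _ _ hth' hx ht)) _.
  apply: ler_wpM2l => //; rewrite norm_triple /= lexx /=.
  by rewrite !subrr !normr0 normr_ge0.
- move=> th x p x' p' t h hth hx hx' hp h01 t0 thT c1 c2.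
  have /andP[h0 _] := h01.
  apply: (hC th x p x' p' t h) => //.
  + apply: inball => //; rewrite t0 /=; apply: le_trans thT; rewrite lerDl; exact: ltW.
  + by apply: inball => //; rewrite thT andbT addr_ge0 // ltW.
  + by apply: le_trans hp _; rewrite /rad; have := T0; lra.
Qed.

Definition res_size (M i : nat) (th : 'rV[R]_m) (x : 'rV[R]_d) : R :=
  enorm (resgrad F H (th, x, i%:R * (T / M%:R))).

Lemma res_size_continuous M i th : continuous (res_size M i th).
Proof.
have rc := ball_lipschitz_continuous (resgrad_ball_lipschitz F3 field_lipschitz).
move=> x; apply: (@continuous_comp _ _ _
  (fun x : 'rV[R]_d => resgrad F H (th, x, i%:R * (T / M%:R))) (@enorm R d));
  last exact: enorm_continuous.
apply: (@continuous_comp _ _ _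
  (fun x : 'rV[R]_d => (th, x, i%:R * (T / M%:R))) (resgrad F H)); last exact: rc.
apply: pair_continuous; last exact: cst_continuous.
by apply: pair_continuous => y; [exact: cst_continuous|exact: cvg_id].
Qed.

Definition position (M i : nat) (x : 'rV[R]_d) : 'rV[R]_d :=
  (numsol Phi g (T / M%:R) i x).1.

Lemma step_itv (M : nat) : T <= M%:R -> 0 < T / M%:R <= 1.
Proof.
move=> TM; have M0 : 0 < M%:R :> R by exact: lt_le_trans TM.
by rewrite divr_gt0 //= ler_pdivrMr // mul1r.
Qed.

Lemma position_continuous M i : T <= M%:R -> continuous (position M i).
Proof.
move=> TM x; apply: (@continuous_comp _ _ _ (numsol Phi g (T / M%:R) i) fst).
  by apply: numsol_continuous; exact: step_itv.
by apply: (@lip_continuous _ _ _ _ 1) => y z; rewrite mul1r; exact: (norm_fst (y - z)).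
Qed.

Definition level_bin (M i : nat) (th : 'rV[R]_m) (B : R) (x : 'rV[R]_d) : 'I_M.+1 :=
  bin M (res_size M i th x / B).

Lemma measurable_level_bin M i th B v : T <= M%:R ->
  measurable ((fun x => level_bin M i th B (position M i x)) @^-1` [set v] : set (borel R d)).
Proof.
move=> TM; apply: (@measurable_bin R M _ (borel R d)
  (fun x : borel R d => res_size M i th (position M i x) / B)).
apply: measurable_funM; last exact: measurable_cst.
apply: borel_continuous => x.
by apply: continuous_comp; [exact: position_continuous|exact: res_size_continuous].
Qed.

Definition deviation (j M N : nat) (eps : R) : R :=
  Num.sqrt (8 * - ln (eps / (2 ^ j.+1)%:R / (M * (2 * j * M).+1 ^ m)%:R) / N%:R).

(** The bin probabilities are those of the initial density, pulled back along the
numerical trajectory, so the exceptional set involves the initial samples only.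
Samples outside the support of the initial density, where trajectories are not under
control, are excluded as well. *)
Lemma deviation_event (M N : nat) (eps : R) (dO : measure_display) (Om : measurableType dO)
    (P : probability Om R) (x0 : 'I_N -> Om -> 'rV[R]_d) (B : nat -> R) :
  T <= M%:R -> (0 < N)%N -> 0 < eps < 1 -> iid_samples P rho0 x0 ->
  exists A : set Om, [/\ measurable A, ((1 - eps)%:E <= P A)%E &
    forall w, A w -> (forall k, supp (x0 k w)) /\
      forall j (i : 'I_M) (c : {ffun 'I_m -> 'I_(2 * j * M).+1}),
        exists q : 'I_M.+1 -> R, [/\
          forall v, (\int[leb R d]_(x in
             (fun x => level_bin M i (grid_point R c) (B j) (position M i x)) @^-1` [set v])
             (rho0 x)%:E = (q v)%:E)%E,
          \sum_v q v = 1 &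
          \sum_v q v * bin_value R v <= N%:R^-1 * \sum_(k < N)
             bin_value R (level_bin M i (grid_point R c) (B j) (position M i (x0 k w)))
             + deviation j M N eps]].
Proof.
move=> TM N0 eps01 [mx dx indep]; have [mrho rho0ge0 rho01] := rho0P.
have M0 : (0 < M)%N by rewrite -(ltr0n R); exact: lt_le_trans TM.
have law k (S : set (borel R d)) : measurable S ->
    P (x0 k @^-1` S) = (\int[leb R d]_(x in S) (rho0 x)%:E)%E.
  by move=> mS; have [_ _ <-] := dx k.
have mpre k (S : set (borel R d)) : measurable S -> measurable (x0 k @^-1` S).
  by move=> mS; rewrite -[X in measurable X]setTI; exact: mx.
pose I j : finType := ('I_M * {ffun 'I_m -> 'I_(2 * j * M).+1})%type.
have cardI j : #|I j| = (M * (2 * j * M).+1 ^ m)%N.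
  by rewrite card_prod card_ord card_ffun !card_ord.
pose b j (p : I j) x := level_bin M p.1 (grid_point R p.2) (B j) (position M p.1 x).
have mb j (p : I j) v : measurable (b j p @^-1` [set v] : set (borel R d)).
  exact: measurable_level_bin.
pose q j (p : I j) v := fine (\int[leb R d]_(x in b j p @^-1` [set v]) (rho0 x)%:E)%E.
have qE j (p : I j) v : (\int[leb R d]_(x in b j p @^-1` [set v]) (rho0 x)%:E = (q j p v)%:E)%E.
  rewrite /q -(law (Ordinal N0)) ?fineK // fin_num_measure //.
  by apply: mpre.
have q1 j (p : I j) : \sum_v q j p v = 1.
  apply: EFin_inj; rewrite -sumEFin -rho01.
  rewrite (integral_fiber_sum _ (mb j p)); first by apply: eq_bigr => v _; rewrite qE.
  - exact/measurable_EFinP.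
  - by move=> x; rewrite lee_fin.
have hD j (p : I j) := @sample_hoeffding _ Om R _ (borel R d) P N x0 _ (b j p) (q j p)
  (bin_value R (M := M)) (deviation j M N eps) N0 mx (mb j p)
  (fun k v => etrans (law k _ (mb j p v)) (qE j p v)) indep (q1 j p)
  (bin_value_itv R M0) (sqrtr_ge0 _).
pose D j p := sval (cid2 (hD j p)).
pose Z := \big[setU/set0]_(k < N) (x0 k @^-1` (~` supp)).
have msupp : measurable (~` supp : set (borel R d)).
  by apply: borel_open; apply: closed_openC; exact: closed_closure.
have mZ : measurable Z by apply: bigsetU_measurable => k _; exact: mpre.
have PZ : P Z = 0%E.
  apply/eqP; rewrite eq_le measure_ge0 andbT.
  apply: le_trans (measure_bigsetU_le _ _ _ (fun k => mpre k _ msupp)) _.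
  rewrite big1 // => k _; apply: etrans (law k _ msupp) _.
  apply: integral0_eq => x nx.
  by rewrite rho0_support.
have eps0 : 0 <= eps by case/andP: eps01 => /ltW.
have PD j (p : I j) : (P (D j p) <= (eps / (2 ^ j.+1)%:R / #|I j|%:R)%:E)%E.
  have [_ hP] := s2valP (cid2 (hD j p)); apply: le_trans hP _.
  have [-> _] := deviation_bound M0 N0 eps01 (erefl _) (erefl (deviation j M N eps)).
  by rewrite cardI.
have mD j (p : I j) : measurable (D j p) by case: (s2valP (cid2 (hD j p))).
have [A [mA PA hA]] := countable_union_bound eps0 mZ PZ mD PD.
exists A; split => // w Aw; have [nZ nD] := hA w Aw; split.
  move=> k; apply: contrapT => nsupp; apply: nZ.
  exact: (@in_bigsetU _ _ _ xpredT _ _ k).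
move=> j i c; exists (q j (i, c)); split.
- by move=> v; exact: (qE j (i, c)).
- exact: q1.
- exact: (s2valP' (cid2 (hD j (i, c)))) w (nD j (i, c)).
Qed.

End hamilton_jacobi.

Theorem theorem3p1 (R : realType) (d m r : nat) (T L1 L2 : R)
    (H : 'rV[R]_d -> 'rV[R]_d -> R)
    (g : 'rV[R]_d -> R)
    (rho0 : 'rV[R]_d -> R)
    (Phi : R -> 'rV[R]_d * 'rV[R]_d -> 'rV[R]_d * 'rV[R]_d)
    (psi : 'rV[R]_m -> 'rV[R]_d -> R -> R)
    (T_gt0 : 0 < T)
    (H_diff : forall z : 'rV[R]_d * 'rV[R]_d,
       differentiable (fun z : 'rV[R]_d * 'rV[R]_d => H z.1 z.2) z)
    (H_convex : forall x, @convex_function R 'rV[R]_d setT (H x))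
    (L1_ge0 : 0 <= L1) (L2_ge0 : 0 <= L2)
    (H_L1 : lipschitz_with L1 (dHp H))
    (H_L2 : lipschitz_with L2 (dHx H))
    (g_C1 : Ck 1 g)
    (rho0_density : prob_density rho0)
    (rho0_compact : compact (closure [set x : 'rV[R]_d | rho0 x != 0]))
    (r_ge2 : (2 <= r)%N)
    (Phi_order : integrator_of_order H Phi r)
    (psi_C3 : Ck_on 3 [set y : 'rV[R]_m * 'rV[R]_d * R | 0 <= y.2 <= T]
                (fun y => psi y.1.1 y.1.2 y.2)) :
  exists lambda eta nu Rc : 'rV[R]_m -> R -> R,
    (forall theta t, [/\ 0 <= lambda theta t, 0 <= eta theta t,
                         0 <= nu theta t & 0 <= Rc theta t]) /\
    forall (M : nat) (eps : R) (rhot : nat -> 'rV[R]_d -> R)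
      (dO : measure_display) (Om : measurableType dO) (P : probability Om R)
      (N N0 : nat) (x0 : 'I_N -> Om -> 'rV[R]_d) (theta : Om -> 'rV[R]_m),
    let h := T / M%:R in
    Num.max T (T / 2 * (L1 + L2) * expR (L1 + L2)) <= M%:R ->
    0 < eps < 1 ->
    iid_samples P rho0 x0 ->
    (0 < N0 <= N)%N ->
    (forall w, exists2 B : {set 'I_N}, #|B| = N0 &
       forall theta' : 'rV[R]_m,
         loss Phi g (psi (theta w)) h M (fun k => x0 k w) B
           <= loss Phi g (psi theta') h M (fun k => x0 k w) B) ->
    exists A : set Om, [/\ measurable A, ((1 - eps)%:E <= P A)%E &
      forall w, A w -> forall i, (1 <= i < M)%N ->
        image_density rho0 (fun x => (numsol Phi g h i x).1) (rhot i) ->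
        let t := i%:R * h in
        let u := psi (theta w) in
        let X := fun k => x0 k w in
        (\int[leb R d]_x
            (enorm (grad (hj_residual H u t) x) * rhot i x)%:E <=
         (1 / 2 * lambda (theta w) t * h
          + eta (theta w) t * h ^+ r.-1
          + delta_err Phi g u h X i
          + nu (theta w) t * eps_err Phi g u h X i
          + Rc (theta w) t
              * Num.sqrt ((ln M%:R + ln (2 / eps)) / (2 * N%:R)))%:E)%E].
Proof.
have [F F3 FE] := psi_C3.
have psiE th x t : 0 <= t <= T -> psi th x t = F (th, x, t).
  by move=> t0T; rewrite (FE (th, x, t)) // inE.
have fieldL := field_lipschitz L1_ge0 L2_ge0 H_L1 H_L2.
set L := (L1 + L2) * (d + d)%:R in fieldL.
have L0 : 0 <= L by rewrite mulr_ge0 // addr_ge0.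
have [rho rho_ge0 numsolP] := numsol_bounded T_gt0 L1_ge0 L2_ge0 H_L1 H_L2 g_C1
  rho0_compact r_ge2 Phi_order.
have [kappa kappa0 stepP] := integrator_consistent L0 fieldL r_ge2 Phi_order rho.
have /choice[k kP] := fun j => level_constants T_gt0 L1_ge0 L2_ge0 H_L1 H_L2 F3 j rho_ge0 kappa0.
(* The constants depend on the parameter through an integer bound of its norm only. *)
pose lev (theta : 'rV[R]_m) := (Num.truncn `|theta|).+1.
pose B j := (k j).1.1; pose Lam j := (k j).1.2; pose C j := (k j).2.
have B0 j : 0 < B j by case: (kP j).
have Lam0 j : 0 <= Lam j by case: (kP j).
have C0 j : 0 <= C j by case: (kP j).
(* [h / T = 1 / M] turns the rounding and grid errors into multiples of [h].
   The local error of order [h^(r-1)] is at most [h], so [eta = 0] will do. *)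
exists (fun theta _ => 2 * (C (lev theta) + (B (lev theta) + 2 * Lam (lev theta)) / T)).
exists (fun _ _ => 0); exists (fun theta _ => C (lev theta)).
exists (fun theta _ => B (lev theta) * (4 * Num.sqrt (log_rate R m (lev theta)))).
split.
  move=> theta t; split => //.
  - rewrite mulr_ge0 // addr_ge0 // divr_ge0 ?addr_ge0 ?mulr_ge0 // ltW //.
  - by rewrite mulr_ge0 ?mulr_ge0 ?sqrtr_ge0 // ltW.
move=> M eps rhot dO Om P N N0 x0 theta h hM eps01 hiid /andP[N00 N0N] _.
have N_gt0 : (0 < N)%N by exact: leq_trans N0N.
have TM : T <= M%:R by apply: le_trans hM; rewrite le_max lexx.
have M0' : 0 < M%:R :> R by exact: lt_le_trans TM.
have M0 : (0 < M)%N by rewrite -(ltr0n R).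
have h01 : 0 < h <= 1 by exact: step_itv.
have /andP[h0 h1] := h01.
have [A [mA PA hA]] := deviation_event T_gt0 L1_ge0 L2_ge0 H_L1 H_L2 g_C1 rho0_density
  Phi_order F3 B TM N_gt0 eps01 hiid.
exists A; split; [exact: mA|exact: PA|move=> w Aw i /andP[i0 iM] himg; cbv zeta].
set t := i%:R * h; set u := psi (theta w); set X := fun k0 => x0 k0 w.
have [suppX dev] := hA w Aw.
set th := theta w; set j := lev th.
have thj : `|th| <= j%:R by apply: ltW; exact: truncnS_gt.
have [c cth] := grid_dense M0 thj.
have [q [qE q1 qdev]] := dev j (Ordinal iM) c.
have t0T : 0 < t < T.
  rewrite /t /h mulr_gt0 ?ltr0n //= mulrCA gtr_pMr // ltr_pdivrMr // mul1r ltr_nat //.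
have t0T' : 0 <= t <= T by case/andP: t0T => ? ?; rewrite !ltW.
have [mrhot rhot0 rhotE] := himg.
have [_ _ _ [resB resLip] resE] := kP j.
have mpos : measurable_fun [set: borel R d] (position T g Phi M i : borel R d -> borel R d).
  by apply: borel_continuous_map; exact: (position_continuous T_gt0 g_C1 Phi_order TM).
pose G : set (borel R d) := [set x : 'rV[R]_d | `|x| <= rho].
have mG : measurable G.
  by apply: borel_closed; apply: compact_closed => //; exact: compact_ball_row.
have gE x : enorm (grad (hj_residual H u t) x) = res_size T H F M i th x.
  rewrite /res_size; congr enorm; apply: (grad_residual F3 H_diff x t0T) => y s s0T.
  exact: psiE.
have mres th' : measurable_fun [set: borel R d] (res_size T H F M i th' : borel R d -> R).
  by apply: borel_continuous; exact: (res_size_continuous L1_ge0 L2_ge0 H_L1 H_L2 F3).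
have pos_bound x0' : closure [set x : 'rV[R]_d | rho0 x != 0] x0' -> forall i', (i' <= M)%N ->
    `|(numsol Phi g h i' x0').1| <= rho.
  by move=> sx i' i'M; apply: le_trans (norm_fst _) _; exact: numsolP.
have e0 : 0 <= Lam j / M%:R by rewrite divr_ge0.
have rhot_out : (\int[leb R d]_(x in ~` G) (rhot i x)%:E = 0)%E.
  rewrite -rhotE; last exact: measurableC.
  apply: integral0_eq => x /= nGx; congr EFin; apply: rho0_support => sx; apply: nGx.
  by apply: pos_bound => //; exact: ltnW.
have gj : `|grid_point R c| <= j%:R by exact: norm_grid_point.
have grid_bound x : G x -> res_size T H F M i (grid_point R c) x <= B j.
  by move=> Gx; exact: resB.
have grid_close x : G x ->
    `|res_size T H F M i th x - res_size T H F M i (grid_point R c) x| <= Lam j / M%:R.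
  move=> Gx; apply: (le_trans (resLip th (grid_point R c) x t thj gj Gx t0T')).
  by apply: ler_wpM2l; [exact: Lam0|rewrite distrC].
have sample_in l : G (position T g Phi M i (X l)).
  by apply: pos_bound; [exact: suppX|exact: ltnW].
have binE v : (\int[leb R d]_(x in
    (fun x => bin M (res_size T H F M i (grid_point R c) x / B j)) @^-1` [set v])
    (rhot i x)%:E = (q v)%:E)%E.
  have mb : measurable ((fun x => bin M (res_size T H F M i (grid_point R c) x / B j))
      @^-1` [set v] : set (borel R d)).
    apply: (@measurable_bin R M _ (borel R d)
      (fun x : borel R d => res_size T H F M i (grid_point R c) x / B j)).
    by apply: measurable_funM; [exact: mres|exact: measurable_cst].
  exact: etrans (esym (rhotE _ mb)) (qE v).
have main := integral_sample_le M0 N_gt0 (B0 j) e0 mG (mres th) (mres (grid_point R c)) mrhot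
  (fun x => enorm_ge0 _) (fun x => enorm_ge0 _) rhot0 rhot_out grid_bound grid_close
  sample_in binE q1 qdev.
under eq_integral do rewrite gE.
apply: le_trans main _.
rewrite lee_fin.
have [_ devle] := deviation_bound M0 N_gt0 eps01 (erefl _) (erefl (deviation m j M N eps)).
(* At the last step [i' = M] the time is [T], which is why the extension [F] must
   agree with the network on the closed interval. *)
have errE i' l : (i' <= M)%N -> train_err Phi g u h i' (X l)
    = netgrad F (th, (numsol Phi g h i' (X l)).1, i'%:R * h) - (numsol Phi g h i' (X l)).2.
  move=> i'M; rewrite /train_err.
  have -> : (fun y => u y (i'%:R * h)) = (fun y => F (th, y, i'%:R * h)).
    apply/funext => y; apply: psiE; rewrite mulr_ge0 ?(ltW h0) //= /h mulrCA.
    by rewrite ger_pMr // ler_pdivrMr // mul1r ler_nat.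
  by rewrite netgrad_slice.
have sample l : res_size T H F M i th (position T g Phi M i (X l)) <=
    enorm (train_err Phi g u h i.+1 (X l) - train_err Phi g u h i (X l)) / h
    + C j * (h + enorm (train_err Phi g u h i (X l))).
  rewrite !errE //; last exact: ltnW.
  rewrite /res_size -/h -/t.
  have tS : i.+1%:R * h = t + h by rewrite -natr1 mulrDl mul1r.
  rewrite tS.
  set z := numsol Phi g h i (X l).
  have zrho : `|z| <= rho by apply: numsolP => //; [exact: ltnW|exact: suppX].
  have zS : numsol Phi g h i.+1 (X l) = Phi h z by [].
  rewrite zS.
  have step := stepP z h zrho h01.
  apply: resE => //.
  - exact: le_trans (norm_fst z) zrho.
  - rewrite -zS; apply: pos_bound => //; exact: suppX.
  - exact: le_trans (norm_snd z) zrho.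
  - by case/andP: t0T'.
  - rewrite -tS /h mulrCA ger_pMr // ler_pdivrMr // mul1r ler_nat //.
  - exact: le_trans (norm_fst _) step.
  - apply: le_trans step; have := norm_snd (Phi h z - z - h *: ham_field H z).
    by rewrite /= scalerN opprK.
have N0' : 0 < N%:R :> R by rewrite ltr0n.
have avg : N%:R^-1 * \sum_(l < N) res_size T H F M i th (position T g Phi M i (X l))
    <= delta_err Phi g u h X i + C j * h + C j * eps_err Phi g u h X i.
  have -> : delta_err Phi g u h X i + C j * h + C j * eps_err Phi g u h X i
    = N%:R^-1 * \sum_(l < N) (enorm (train_err Phi g u h i.+1 (X l) - train_err Phi g u h i (X l)) / h
    + C j * (h + enorm (train_err Phi g u h i (X l)))).
    rewrite big_split /= -mulr_sumr big_split /= sumr_const card_ord -[h *+ N]mulr_natl.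
    rewrite /delta_err /eps_err; set S1 := \sum_(_ < N) (_ / _); set S2 := \sum_(_ < N) enorm _.
    by field; rewrite gt_eqF.
  by apply: ler_wpM2l; [rewrite invr_ge0 ltW|apply: ler_sum => l _].
have hT : h / T = M%:R^-1 by rewrite /h mulrAC divff ?gt_eqF // mul1r.
have dev2 := ler_wpM2l (ltW (B0 j)) devle.
have E1 : 1 / 2 * (2 * (C j + (B j + 2 * Lam j) / T)) * h
   = C j * h + B j / M%:R + 2 * (Lam j / M%:R).
  by rewrite -hT; field; rewrite gt_eqF.
rewrite -/j E1 mul0r addr0 -!mulrA in dev2 *.
lra.
Qed.
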